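(* Let $n\ge 1$ be an integer and consider $u_*(x,y)=(y^n,0)$ on $M=\mathbb{T}\times[-1,1]$. Then for every $\varepsilon>0$ and every $\alpha\in(0,1)$ there exist smooth non-shear solutions $u(t)$ of the Euler equations on $M$ of each of the following types: stationary; time periodic; and quasiperiodic in time with $N$ non-commensurate frequencies, for any prescribed number $N$; and each of them satisfies $\|u(t)-u_*\|_{C^{n-1,\alpha}(M)}<\varepsilon$ for all time $t$.
   Context: The Euler equations on $M$ are $\partial_t u+u\cdot\nabla u=-\nabla p$, $\nabla\cdot u=0$ in $M$, $u\cdot\hat n=0$ on $\partial M$. A shear flow is a field of the form $(v(y),0)$; non-shear means not of this form. Time periodic means non-stationary and periodic in $t$. A solution is quasiperiodic with $N$ non-commensurate frequencies if $u(t)=V(\omega_1t,\dots,\omega_Nt)$ for some continuous $V$ on the $N$-torus with values in velocity fields and rationally independent $\omega_1,\dots,\omega_N$, where this cannot be done with fewer than $N$ frequencies. $C^{n-1,\alpha}$ is the usual Hölder space of functions with $n-1$ derivatives, the $(n-1)$-st being $\alpha$-Hölder; the paper writes $C^{n-}$ for $C^{n-1,\alpha}$ with arbitrary $0<\alpha<1$. *)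

(* Defs.v *)
From HB Require Import structures.
From mathcomp Require Import all_boot all_order all_algebra.
From mathcomp Require Import all_classical all_reals all_analysis.

Set Implicit Arguments.
Unset Strict Implicit.
Unset Printing Implicit Defensive.

Import Order.TTheory GRing.Theory Num.Theory.
Import numFieldNormedType.Exports.

Local Open Scope classical_set_scope.
Local Open Scope ring_scope.

(* C^oo: every iterated directional derivative is Frechet differentiable
   everywhere.  In finite dimension this is the usual notion. *)
Definition smooth (R : realType) (E F : normedModType R) (f : E -> F) : Prop :=
  forall (s : seq E) (z : E), differentiable (foldr (fun v g => 'D_v g) f s) z.

Section Channel.
Variable R : realType.

Local Notation P := (R * R)%type.

(* Conventions.  T = R / 2 pi Z, and M = T x [-1, 1] is handled on its universal
   cover: a function on M is a function of (x, y) that is 2 pi-periodic in x,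
   of which only the values on the strip |y| <= 1 matter.  A smooth function on
   M (up to the boundary) is the restriction of a smooth function on the plane;
   the derivatives on the strip, boundary included, do not depend on the choice
   of the extension. *)
Definition strip : set P := [set z | -1 <= z.2 <= 1].

Definition xperiodic (F : Type) (f : P -> F) : Prop :=
  forall x y : R, f (x + 2 * pi, y) = f (x, y).

Definition dx (F : normedModType R) (f : P -> F) : P -> F := 'D_((1, 0) : P) f.
Definition dy (F : normedModType R) (f : P -> F) : P -> F := 'D_((0, 1) : P) f.

(* ∂_x^i ∂_y^j f *)
Definition partial (F : normedModType R) (i j : nat) (f : P -> F) : P -> F :=
  iter i (@dx F) (iter j (@dy F) f).

Definition sup_norm (F : normedModType R) (f : P -> F) : \bar R :=
  ereal_sup [set (`|f z|)%:E | z in strip].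

(* Since f is 2 pi-periodic in x, the supremum over the universal cover is the
   supremum over M with its quotient distance.  `|z - w| is the maximum norm of
   the plane, equivalent to the Euclidean one. *)
Definition holder_seminorm (F : normedModType R) (a : R) (f : P -> F) : \bar R :=
  ereal_sup [set r | exists z w : P, [/\ strip z, strip w, z != w
                      & r = (`|f z - f w| / `|z - w| `^ a)%:E]].

Definition Ck_norm (F : normedModType R) (k : nat) (f : P -> F) : \bar R :=
  (\sum_(i < k.+1) \sum_(j < k.+1 | (i + j <= k)%N) sup_norm (partial i j f))%E.

(* The norm of C^{k,a}(M). *)
Definition holder_norm (F : normedModType R) (k : nat) (a : R) (f : P -> F) :
    \bar R :=
  (Ck_norm k f + \sum_(i < k.+1) holder_seminorm a (partial i (k - i)%N f))%E.

(* A smooth incompressible field on M, tangent to the boundary. *)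
Record velocity_field (w : P -> P) : Prop := VelocityField {
  vf_smooth : smooth w;
  vf_xperiodic : xperiodic w;
  vf_div : forall z, strip z -> (dx w z).1 + (dy w z).2 = 0;
  vf_tangent : forall x : R, (w (x, 1)).2 = 0 /\ (w (x, -1)).2 = 0
}.

Record euler_pair (u : R -> P -> P) (p : R -> P -> R) : Prop := EulerPair {
  ep_smooth_u : smooth (fun q : R * P => u q.1 q.2);
  ep_smooth_p : smooth (fun q : R * P => p q.1 q.2);
  ep_velocity : forall t, velocity_field (u t);
  ep_xperiodic_p : forall t, xperiodic (p t);
  ep_momentum : forall t z, strip z ->
    derive1 (fun s => u s z) t
      + ((u t z).1 *: dx (u t) z + (u t z).2 *: dy (u t) z)
    = - (dx (p t) z, dy (p t) z)
}.

Definition euler_solution (u : R -> P -> P) : Prop :=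
  exists p : R -> P -> R, euler_pair u p.

Definition shear (w : P -> P) : Prop :=
  exists v : R -> R, forall z, strip z -> w z = (v z.2, 0).

Definition non_shear (u : R -> P -> P) : Prop := forall t, ~ shear (u t).

Definition stationary (u : R -> P -> P) : Prop :=
  forall t s z, strip z -> u t z = u s z.

Definition time_periodic (u : R -> P -> P) : Prop :=
  ~ stationary u /\
  exists2 T : R, 0 < T & forall t z, strip z -> u (t + T) z = u t z.

Definition rationally_independent (N : nat) (omega : 'I_N -> R) : Prop :=
  forall k : 'I_N -> int,
    \sum_(i < N) (k i)%:~R * omega i = 0 -> forall i, k i = 0.

(* A continuous map from the torus (R / 2 pi Z)^N to the space of smooth velocity
   fields on M with its C^oo topology, i.e. continuous for every C^k norm. *)
Record torus_map (N : nat) (V : 'rV[R]_N -> P -> P) : Prop := TorusMap {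
  tm_periodic : forall theta (i : 'I_N) z, strip z ->
    V (theta + (2 * pi) *: delta_mx 0 i) z = V theta z;
  tm_velocity : forall theta, velocity_field (V theta);
  tm_continuous : forall (k : nat) theta,
    Ck_norm k (V theta' \- V theta) @[theta' --> theta] --> 0%E
}.

Definition has_frequencies (N : nat) (u : R -> P -> P) : Prop :=
  exists (omega : 'I_N -> R) (V : 'rV[R]_N -> P -> P),
    [/\ rationally_independent omega, torus_map V
      & forall t z, strip z -> u t z = V (\row_i (omega i * t)) z].

Definition quasiperiodic (N : nat) (u : R -> P -> P) : Prop :=
  has_frequencies N u /\ forall m, (m < N)%N -> ~ has_frequencies m u.

(* u_* = (y^n, 0) *)
Definition power_shear (n : nat) : P -> P := fun z => (z.2 ^+ n, 0).

End Channel.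

(* Main.v *)
(* Replace y^n by a profile which, in the scaled variable y/delta, is constant
   on N disjoint bands near y = 0; the change is delta^n g(y/delta) with g
   smooth and compactly supported, hence O(delta^(1-alpha)) in C^{n-1,alpha}.
   Where the velocity is a constant c_i, one may superpose a steady compactly
   supported radial vortex translated at speed c_i, again of the form
   delta^n w(z/delta): this is an exact Euler solution by Galilean invariance,
   and vortices in different bands do not interact.  The phase of the i-th
   vortex rotates with frequency delta^n c_i, so c = 0 gives a stationary flow,
   c = 1 with N = 1 a periodic one, and rationally independent c_i an
   N-frequency flow.

   Fewer than N frequencies omega'_1, ..., omega'_m do not suffice, because each
   frequency c of the flow is an integer combination of the omega'_j.  Otherwise
   there are times t for which all the omega'_j t are close to 0 modulo 2 pi,
   whereas c t is not (Kronecker); at such times a map that is continuous on the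
   m-torus returns close to its initial value, but the vortex has moved away
   from its initial position.  Kronecker's theorem follows by comparing the mean
   values of p(t) and p(t) cos(ct) for p(t) = prod_j ((1 + cos omega'_j t)/2)^M,
   M large. *)

Require Import Defs.
From HB Require Import structures.
From mathcomp Require Import all_boot all_order all_algebra.
From mathcomp Require Import all_classical all_reals all_analysis.
From mathcomp Require Import finmap zify ring lra.

Set Implicit Arguments.
Unset Strict Implicit.
Unset Printing Implicit Defensive.

Import Order.TTheory GRing.Theory Num.Theory.
Import numFieldNormedType.Exports.

Local Open Scope classical_set_scope.
Local Open Scope ring_scope.

(** * Iterated derivatives and smooth functions *)

(** The word acts from the right: its last vector is differentiated first. [smooth] asks that all
    these functions be differentiable. *)
Definition Dseq (R : realType) (E F : normedModType R) (s : seq E) (f : E -> F) :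
  E -> F := foldr (fun v g => 'D_v g) f s.

Section SmoothCalculus.
Variable R : realType.
Implicit Types E F G : normedModType R.

Lemma Dseq_rcons E F (s : seq E) v (f : E -> F) :
  Dseq (rcons s v) f = Dseq s ('D_v f).
Proof. by rewrite /Dseq foldr_rcons. Qed.

Lemma Dseq_cat E F (s1 s2 : seq E) (f : E -> F) :
  Dseq (s1 ++ s2) f = Dseq s1 (Dseq s2 f).
Proof. by rewrite /Dseq foldr_cat. Qed.

(* Coinduction: smooth functions form the largest class of differentiable
   functions closed under directional derivatives. *)
Lemma smooth_coind E F (C : (E -> F) -> Prop) :
    (forall f, C f -> (forall z, differentiable f z) /\ forall v, C ('D_v f)) ->
  forall f, C f -> smooth f.
Proof.
move=> H f Cf s; suff : C (Dseq s f) by move/H => [].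
by elim: s => //= v s /H [_]; exact.
Qed.

Lemma smooth_differentiable E F (f : E -> F) z : smooth f -> differentiable f z.
Proof. by move=> sf; exact: (sf [::]). Qed.

Lemma smooth_derivable E F (f : E -> F) z v : smooth f -> derivable f z v.
Proof. by move=> sf; apply: diff_derivable; exact: smooth_differentiable. Qed.

Lemma smooth_continuous E F (f : E -> F) : smooth f -> continuous f.
Proof.
by move=> sf z; apply: differentiable_continuous; exact: smooth_differentiable.
Qed.

Lemma smooth_Dseq E F (s : seq E) (f : E -> F) : smooth f -> smooth (Dseq s f).
Proof.
by move=> sf s' z; rewrite -[foldr _ _ _]/(Dseq _ _) -Dseq_cat; exact: sf.
Qed.

Lemma smooth_derive E F v (f : E -> F) : smooth f -> smooth ('D_v f).
Proof. exact: (@smooth_Dseq _ _ [:: v]). Qed.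

Lemma derive_diff E F (f df : E -> F) z v : is_diff z f df -> 'D_v f z = df v.
Proof.
by move=> [dz <-]; exact: deriveE.
Qed.

Lemma deriveZv E F (f : E -> F) z (k : R) v :
  differentiable f z -> 'D_(k *: v) f z = k *: 'D_v f z.
Proof. by move=> df; rewrite !deriveE// linearZ. Qed.

Lemma deriveDv E F (f : E -> F) z v w :
  differentiable f z -> 'D_(v + w) f z = 'D_v f z + 'D_w f z.
Proof. by move=> df; rewrite !deriveE// linearD. Qed.

(** Agreement near a point is agreement near every neighbouring point too, so it passes to
    derivatives by induction. *)
Lemma Dseq_near E F (s : seq E) (f g : E -> F) z :
  {near z, f =1 g} -> Dseq s f z = Dseq s g z.
Proof.
move=> fg; suff : {near z, Dseq s f =1 Dseq s g} by exact: nbhs_singleton.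
elim: s => //= v s IH.
have : \forall w \near z, {near w, Dseq s f =1 Dseq s g} by exact: nbhs_interior.
rewrite /prop_near1; apply: filterS => w wfg.
exact: near_eq_derive.
Qed.

Lemma derive_near E F v (f g : E -> F) z :
  {near z, f =1 g} -> 'D_v f z = 'D_v g z.
Proof. exact: (@Dseq_near _ _ [:: v]). Qed.

Lemma smooth_cst E F (a : F) : smooth (cst a : E -> F).
Proof.
apply: (@smooth_coind _ _ (fun f => exists a, f = cst a)); last by exists a.
move=> _ [b ->]; split=> [z|v]; first exact: differentiable_cst.
by exists 0; apply/funext => z; rewrite derive_cst.
Qed.

Lemma Dseq_compl E F G (L : {linear F -> G}) s (f : E -> F) :
    continuous L -> smooth f ->
  Dseq s (fun z => L (f z)) = fun z => L (Dseq s f z).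
Proof.
move=> Lc sf; elim: s => //= v s ->; apply/funext => z.
have dL w : differentiable L w by exact: linear_differentiable.
have di := sf s z.
rewrite -[LHS]/('D_v (L \o Dseq s f) z) deriveE; last exact: differentiable_comp.
by rewrite diff_comp//= diff_lin// deriveE.
Qed.

Lemma smooth_compl E F G (L : {linear F -> G}) (f : E -> F) :
  continuous L -> smooth f -> smooth (fun z => L (f z)).
Proof.
move=> Lc sf s z; rewrite -[foldr _ _ _]/(Dseq _ _) Dseq_compl//.
by apply: (@differentiable_comp _ _ _ _ (Dseq s f) L); [exact: sf|exact: linear_differentiable].
Qed.

Lemma differentiable_affine E F (L : {linear E -> F}) b z :
  continuous L -> differentiable (fun z => L z + b) z.
Proof.
move=> Lc; apply: (@differentiableD _ _ _ L (cst b)).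
  exact: linear_differentiable.
exact: differentiable_cst.
Qed.

Lemma derive_affine E F (L : {linear E -> F}) b v z :
  continuous L -> 'D_v (fun z => L z + b) z = L v.
Proof.
move=> Lc; have dL w : differentiable L w by exact: linear_differentiable.
have dc w : differentiable (cst b) w := @differentiable_cst R E F b w.
rewrite -[LHS]/('D_v (L \+ cst b) z) deriveD; do ?exact: diff_derivable.
by rewrite derive_cst addr0 deriveE// diff_lin.
Qed.

Lemma Dseq_affine E F G (L : {linear E -> F}) b s (f : F -> G) :
    continuous L -> smooth f ->
  Dseq s (fun z => f (L z + b)) = fun z => Dseq (map L s) f (L z + b).
Proof.
move=> Lc sf; elim: s => //= v s ->; apply/funext => z.
have di := sf (map L s) (L z + b).
have dL := differentiable_affine b z Lc.
rewrite -[LHS]/('D_v (Dseq (map L s) f \o (fun z => L z + b)) z).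
rewrite deriveE; last exact: differentiable_comp.
by rewrite diff_comp//= -(deriveE _ dL) derive_affine// deriveE.
Qed.

Lemma smooth_affine E F G (L : {linear E -> F}) b (f : F -> G) :
  continuous L -> smooth f -> smooth (fun z => f (L z + b)).
Proof.
move=> Lc sf s z; rewrite -[foldr _ _ _]/(Dseq _ _) Dseq_affine//.
apply: (@differentiable_comp _ _ _ _ (fun z => L z + b) (Dseq (map L s) f)).
  exact: differentiable_affine.
exact: sf.
Qed.

Lemma DseqD E F s (f g : E -> F) : smooth f -> smooth g ->
  Dseq s (fun z => f z + g z) = fun z => Dseq s f z + Dseq s g z.
Proof.
move=> sf sg; elim: s => //= v s ->; apply/funext => z.
by rewrite -deriveD//; apply: diff_derivable; [exact: sf|exact: sg].
Qed.

Lemma smoothD E F (f g : E -> F) :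
  smooth f -> smooth g -> smooth (fun z => f z + g z).
Proof.
move=> sf sg s z; rewrite -[foldr _ _ _]/(Dseq _ _) DseqD//.
by apply: (@differentiableD _ _ _ (Dseq s f)); [exact: sf|exact: sg].
Qed.

Lemma DseqZ E F s k (f : E -> F) : smooth f ->
  Dseq s (fun z => k *: f z) = fun z => k *: Dseq s f z.
Proof. by move=> sf; apply: (Dseq_compl (L := *:%R k)) => //; exact: scaler_continuous. Qed.

Lemma smoothZ E F k (f : E -> F) : smooth f -> smooth (fun z => k *: f z).
Proof. by move=> sf; apply: (smooth_compl (L := *:%R k)) => //; exact: scaler_continuous. Qed.

Lemma smooth_sum E F I (r : seq I) (f : I -> E -> F) :
  (forall i, smooth (f i)) -> smooth (fun z => \sum_(i <- r) f i z).
Proof.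
move=> sf; elim: r => [|i r IH].
  under eq_fun do rewrite big_nil; exact: smooth_cst.
by under eq_fun do rewrite big_cons; exact: smoothD.
Qed.

Lemma Dseq_cst0 E F (s : seq E) : Dseq s (cst (0 : F)) = cst 0.
Proof.
by elim: s => //= v s ->; apply/funext => z; rewrite derive_cst.
Qed.

Lemma Dseq_sum E F I (r : seq I) s (f : I -> E -> F) :
    (forall i, smooth (f i)) ->
  Dseq s (fun z => \sum_(i <- r) f i z) = fun z => \sum_(i <- r) Dseq s (f i) z.
Proof.
move=> sf; elim: r => [|i r IH].
  under eq_fun do rewrite big_nil; under [RHS]eq_fun do rewrite big_nil.
  exact: Dseq_cst0.
under eq_fun do rewrite big_cons; under [RHS]eq_fun do rewrite big_cons.
by rewrite DseqD// ?IH//; exact: smooth_sum.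
Qed.

Lemma smooth_linear E F (L : {linear E -> F}) : continuous L -> smooth L.
Proof.
move=> Lc [|v s] z; first exact: linear_differentiable.
suff : exists a, Dseq (v :: s) L = cst a.
  by rewrite -[foldr _ _ _]/(Dseq (v :: s) L) => -[a ->]; exact: differentiable_cst.
elim: s v => [|w s IH] v /=.
  by exists (L v); apply/funext => x; rewrite deriveE ?diff_lin//; exact: linear_differentiable.
have [a] := IH w; rewrite /= => ->; exists 0.
by apply/funext => x; rewrite derive_cst.
Qed.

(** Closing the smooth functions under sum, product and outer composition gives a class stable under
    directional derivatives, since the product and chain rules stay inside it. Coinduction then
    makes all its members smooth. *)
Inductive smooth_algebra E : (E -> R) -> Prop :=
| sa_base f : smooth f -> smooth_algebra f
| sa_add f g : smooth_algebra f -> smooth_algebra g ->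
    smooth_algebra (fun z => f z + g z)
| sa_mul f g : smooth_algebra f -> smooth_algebra g ->
    smooth_algebra (fun z => f z * g z)
| sa_comp (h : R -> R) f : smooth h -> smooth_algebra f ->
    smooth_algebra (fun z => h (f z)).

Lemma derive_comp1 E (h : R -> R) (f : E -> R) z v :
    differentiable h (f z) -> differentiable f z ->
  'D_v (fun z => h (f z)) z = 'D_v f z * 'D_1 h (f z).
Proof.
move=> dh df; rewrite -[LHS]/('D_v (h \o f) z) deriveE; last exact: differentiable_comp.
rewrite diff_comp//= !deriveE//.
by rewrite -[X in 'd h _ X]mulr1 -[_ * 1]/(_ *: 1) linearZ.
Qed.

Lemma smooth_algebraP E (f : E -> R) : smooth_algebra f -> smooth f.
Proof.
move: f; apply: smooth_coind => f; elim=> {f}.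
- move=> f sf; split=> [z|v]; first exact: smooth_differentiable.
  by apply: sa_base; exact: smooth_derive.
- move=> f g _ [df Df] _ [dg Dg]; split=> [z|v]; first exact: differentiableD.
  rewrite [X in smooth_algebra X](_ : _ = fun z => 'D_v f z + 'D_v g z).
    exact: sa_add.
  by apply/funext => z; rewrite -deriveD//; exact: diff_derivable.
- move=> f g sf [df Df] sg [dg Dg]; split=> [z|v]; first exact: differentiableM.
  rewrite [X in smooth_algebra X](_ : _ =
      fun z => f z * 'D_v g z + g z * 'D_v f z).
    by apply: sa_add; apply: sa_mul => //; exact: Df.
  by apply/funext => z; rewrite -deriveM//; exact: diff_derivable.
- move=> h f sh sf [df Df]; split=> [z|v].
    apply: (@differentiable_comp _ _ _ _ f h); [exact: df|exact: smooth_differentiable].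
  rewrite [X in smooth_algebra X](_ : _ = fun z => 'D_v f z * 'D_1 h (f z)).
    by apply: sa_mul; [exact: Df|exact: (@sa_comp _ ('D_1 h) f (smooth_derive _ sh) sf)].
  by apply/funext => z; rewrite (@derive_comp1 _ h f)//; exact: smooth_differentiable.
Qed.

Lemma smoothM E (f g : E -> R) :
  smooth f -> smooth g -> smooth (fun z => f z * g z).
Proof. by move=> sf sg; exact: smooth_algebraP (sa_mul (sa_base sf) (sa_base sg)). Qed.

Lemma smooth_comp1 E (h : R -> R) (f : E -> R) :
  smooth h -> smooth f -> smooth (fun z => h (f z)).
Proof. by move=> sh sf; exact: smooth_algebraP (sa_comp sh (sa_base sf)). Qed.

Lemma smoothX E (f : E -> R) n : smooth f -> smooth (fun z => f z ^+ n).
Proof.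
move=> sf; elim: n => [|n IH]; first by under eq_fun do rewrite expr0; exact: smooth_cst.
by under eq_fun do rewrite exprS; exact: smoothM.
Qed.

End SmoothCalculus.

(** * Cutoff functions *)

Section Flat.
Variable R : realType.
Implicit Types p q : {poly R}.

(** The family p(1/x) exp(-1/x), extended by zero, is closed under differentiation, so smoothness
    can be proved for all p at once. *)
Definition flat p (x : R) : R := if 0 < x then p.[x^-1] * expR (- x^-1) else 0.

(** Monomial by monomial, from t^k / k! <= exp t for t >= 0. *)
Lemma poly_expRN_bounded p : exists2 C, 0 <= C &
  forall t : R, 0 <= t -> `|p.[t] * expR (- t)| <= C.
Proof.
exists (\sum_(i < size p) `|p`_i| * i`!%:R); first by apply: sumr_ge0 => i _; exact: mulr_ge0.
move=> t t0; rewrite normrM (ger0_norm (expR_ge0 _)) horner_coef.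
rewrite (le_trans (ler_wpM2r (expR_ge0 _) (ler_norm_sum _ _ _)))//.
rewrite mulr_suml; apply: ler_sum => i _.
rewrite normrM -mulrA ler_wpM2l// ger0_norm ?exprn_ge0// expRN.
rewrite ler_pdivrMr ?expR_gt0//.
case: (nat_of_ord i) => [|k].
  by rewrite expr0 mul1r; apply: le_trans (expR_ge1Dx t); rewrite lerDl.
rewrite mulrC -ler_pdivrMr ?ltr0n ?fact_gt0//.
by apply: le_trans (expR_ge1Dxn k t0); rewrite lerDr.
Qed.

Lemma flat_neg p x : x <= 0 -> flat p x = 0.
Proof. by rewrite /flat => x0; rewrite ltNge x0. Qed.

Lemma flat_pos p x : 0 < x -> flat p x = p.[x^-1] * expR (- x^-1).
Proof. by rewrite /flat => ->. Qed.

(** Quadratic smallness makes the derivative at the origin vanish. It is the preceding bound for p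
    X^2 at the point 1/x. *)
Lemma flat_le_sqr p : exists2 C, 0 <= C & forall x, `|flat p x| <= C * x ^+ 2.
Proof.
have [C C0 HC] := poly_expRN_bounded (p * 'X^2).
exists C => // x; have [x0|x0] := leP x 0.
  by rewrite flat_neg// normr0 mulr_ge0// sqr_ge0.
rewrite flat_pos// -ler_pdivrMr ?exprn_gt0//.
have := HC x^-1 _; rewrite invr_ge0 ltW// => /(_ isT).
rewrite hornerM hornerXn mulrAC normrM (ger0_norm (sqr_ge0 _)).
by rewrite exprVn.
Qed.

(** With t = 1/x one has dt/dx = - t^2, and p(t) exp(-t) has t-derivative (p' - p)(t) exp(-t); hence
    the polynomial X^2 (p - p'). *)
Lemma is_derive_flat p (x : R) : is_derive x 1 (flat p) (flat ('X^2 * (p - p^`())) x).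
Proof.
have [x0|x0|->] := ltgtP x 0.
- rewrite flat_neg ?ltW//; apply: (@near_eq_is_derive _ _ _ (cst 0)).
    near=> y; rewrite flat_neg//; apply: ltW; near: y; exact: lt_nbhsl.
- have dinv : is_derive x 1 (fun y : R => y^-1) (- x ^- 2).
    have := @deriveV R R id x 1; rewrite /= derive_id.
    move=> d; apply: DeriveDef.
      by apply: (@derivableV _ _ id) => //; rewrite gt_eqF.
    by rewrite d ?gt_eqF// -[LHS]/(_ * 1) mulr1.
  have dpos : is_derive x 1 (fun y : R => p.[y^-1] * expR (- y^-1))
      (flat ('X^2 * (p - p^`())) x).
    have di : differentiable (fun y : R => y^-1) x by exact/derivable1_diffP.
    have dp : differentiable (horner p) (x^-1).
      exact/derivable1_diffP/derivable_horner.
    have de : differentiable expR (- x^-1) by exact/derivable1_diffP/derivable_expR.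
    have dni : differentiable (fun y : R => - y^-1) x by exact: differentiableN.
    have d1 : derivable (fun y : R => p.[y^-1]) x 1.
      by apply/derivable1_diffP; exact: (differentiable_comp di dp).
    have d2 : derivable (fun y : R => expR (- y^-1)) x 1.
      by apply/derivable1_diffP; exact: (differentiable_comp dni de).
    apply: DeriveDef; first exact: derivableM.
    rewrite deriveM//=.
    rewrite (@derive_comp1 _ _ expR (fun y : R => - y^-1))//.
    rewrite (@derive_comp1 _ _ (horner p) (fun y : R => y^-1))//.
    rewrite deriveN ?derive_val; last by apply: diff_derivable.
    rewrite flat_pos// !hornerE exprVn.
    by rewrite -![_ *: _]/(_ * _); ring.
  apply: near_eq_is_derive dpos; near=> y; rewrite flat_pos//.
  by near: y; exact: lt_nbhsr.
(* At the origin the difference quotient is at most C |h|. *)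
- rewrite flat_neg//; have [C C0 HC] := flat_le_sqr p.
  suff H : h^-1 *: ((flat p \o shift 0) (h *: 1) - flat p 0) @[h --> 0^'] --> 0.
    apply: DeriveDef; first by apply/cvg_ex; exists 0.
    exact: cvg_lim H.
  apply/cvgrPdist_le => e e0; near=> h.
  rewrite sub0r normrN /= (flat_neg p (lexx 0)) subr0 addr0 -![_ *: _]/(_ * _) mulr1.
  have h0 : h != 0 by near: h; exact: nbhs_dnbhs_neq.
  rewrite normrM normfV mulrC ler_pdivrMr ?normr_gt0//.
  apply: le_trans (HC h) _; rewrite -(real_normK (num_real h)).
  rewrite expr2 mulrA ler_wpM2r//.
  have : `|h| <= e / (C + 1).
    near: h; apply: dnbhs0_le; rewrite divr_gt0// ltr_wpDl//.
  rewrite ler_pdivlMr ?ltr_wpDl// mulrC; apply: le_trans.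
  by rewrite ler_wpM2r// lerDl.
Unshelve. all: by end_near. Qed.

End Flat.

Section SmoothMore.
Variable R : realType.
Implicit Types E F G : normedModType R.

Lemma continuous_fst E F : continuous (@fst E F).
Proof. by move=> z; exact: cvg_fst. Qed.

Lemma continuous_snd E F : continuous (@snd E F).
Proof. by move=> z; exact: cvg_snd. Qed.

Lemma smooth_fst E F : smooth (@fst E F).
Proof. by apply: (@smooth_linear _ _ _ fst); exact: continuous_fst. Qed.

Lemma smooth_snd E F : smooth (@snd E F).
Proof. by apply: (@smooth_linear _ _ _ snd); exact: continuous_snd. Qed.

Lemma smooth_id E : smooth (fun z : E => z).
Proof. by apply: (@smooth_linear _ _ _ idfun) => z. Qed.

Lemma Dseq_pair E F G s (f : E -> F) (g : E -> G) : smooth f -> smooth g ->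
  Dseq s (fun z => (f z, g z)) = fun z => (Dseq s f z, Dseq s g z).
Proof.
move=> sf sg; elim: s => //= v s ->; apply/funext => z.
have df := sf s z; have dg := sg s z.
rewrite deriveE; last exact: differentiable_pair.
by rewrite diff_pair//= !deriveE.
Qed.

Lemma smooth_pair E F G (f : E -> F) (g : E -> G) :
  smooth f -> smooth g -> smooth (fun z => (f z, g z)).
Proof.
move=> sf sg s z; rewrite -[foldr _ _ _]/(Dseq _ _) Dseq_pair//.
by apply: differentiable_pair; [exact: sf|exact: sg].
Qed.

Lemma Dseq_shift E F s (f : E -> F) b : smooth f ->
  Dseq s (fun z => f (z - b)) = fun z => Dseq s f (z - b).
Proof.
move=> sf; rewrite (Dseq_affine (L := idfun) (- b) s _ sf) ?map_id//.
by move=> z.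
Qed.

Lemma smooth_shift E F (f : E -> F) b : smooth f -> smooth (fun z => f (z - b)).
Proof.
by move=> sf; apply: (smooth_affine (L := idfun) (- b) _ sf) => z.
Qed.

Lemma Dseq_scaleargs E F s k (f : E -> F) : smooth f ->
  Dseq [seq k *: v | v <- s] f = fun z => k ^+ size s *: Dseq s f z.
Proof.
move=> sf; elim: s => [|v s IH] /=.
  by apply/funext => z; rewrite expr0 scale1r.
rewrite IH; apply/funext => z; have di := sf s z.
rewrite deriveZv; last exact: differentiableZ.
by rewrite deriveZ ?exprS ?scalerA//; exact: diff_derivable.
Qed.

Lemma Dseq_dilate E F s k (f : E -> F) : smooth f ->
  Dseq s (fun z => f (k *: z)) = fun z => k ^+ size s *: Dseq s f (k *: z).
Proof.
move=> sf; have := @Dseq_affine _ _ _ _ ( *:%R k) 0 s _ (@scaler_continuous _ _ k) sf.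
by under eq_fun do rewrite addr0; move=> ->; apply/funext => z; rewrite addr0 Dseq_scaleargs.
Qed.

Lemma smooth_dilate E F k (f : E -> F) : smooth f -> smooth (fun z => f (k *: z)).
Proof.
move=> sf; have := @smooth_affine _ _ _ _ ( *:%R k) 0 _ (@scaler_continuous _ _ k) sf.
by under eq_fun do rewrite addr0.
Qed.

Definition bounded_derivs E F (f : E -> F) :=
  forall s, exists K, forall z, `|Dseq s f z| <= K.

(** On the compact set continuity gives a bound; its complement is open and f vanishes there, so
    every derivative does as well. *)
Lemma compact_support_bounded E F (f : E -> F) (A : set E) :
    smooth f -> compact A -> (forall z, ~ A z -> f z = 0) ->
  bounded_derivs f.
Proof.
move=> sf cA f0 s; have clA := compact_closed (@norm_hausdorff _ _) cA.
have cD : {within A, continuous (Dseq s f)}.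
  by apply: continuous_subspaceT; apply: smooth_continuous; exact: smooth_Dseq.
have [M [Mr HM]] := compact_bounded (continuous_compact cD cA).
exists (Num.max 0 (M + 1)) => z; have [Az|nAz] := pselect (A z).
  rewrite le_max; apply/orP; right; apply: (HM (M + 1)); first by rewrite ltrDl.
  by exists z.
rewrite le_max; apply/orP; left.
rewrite (@Dseq_near _ _ _ s f (cst 0)) ?Dseq_cst0 ?normr0//.
have : nbhs z (~` A) by apply: open_nbhs_nbhs; split => //; exact: closed_openC.
by apply: filterS => w; exact: f0.
Qed.

Lemma bounded_derivs_derive E F v (f : E -> F) :
  bounded_derivs f -> bounded_derivs ('D_v f).
Proof. by move=> bf s; have [K] := bf (rcons s v); rewrite Dseq_rcons; exists K. Qed.

(* A uniform bound over the words in a finite alphabet, as opposed to a bound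
   for each word. *)
Lemma bounded_derivs_uniform E F (f : E -> F) (e : seq E) n : bounded_derivs f ->
  exists2 K, 0 <= K & forall s, (size s <= n)%N -> {subset s <= e} ->
    forall z, `|Dseq s f z| <= K.
Proof.
elim: n f => [|n IH] f bf.
  have [K HK] := bf [::]; exists K; first exact: le_trans (HK 0).
  by case.
have [K HK] := bf [::]; have K0 : 0 <= K by exact: le_trans (HK 0).
suff [L L0 HL] : exists2 L, 0 <= L & forall s v, v \in e -> (size s <= n)%N ->
    {subset s <= e} -> forall z, `|Dseq s ('D_v f) z| <= L.
  exists (K + L); first exact: addr_ge0.
  case/lastP=> [_ _ z|s v]; first by rewrite (le_trans (HK z))// lerDl.
  rewrite size_rcons ltnS Dseq_rcons => sn se z.
  rewrite (le_trans (HL _ _ _ sn _ z)) ?lerDr//.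
    by apply: se; rewrite mem_rcons mem_head.
  by move=> w ws; apply: se; rewrite mem_rcons in_cons ws orbT.
have : forall e' : seq E, exists2 L, 0 <= L & forall s v, v \in e' -> (size s <= n)%N ->
    {subset s <= e} -> forall z, `|Dseq s ('D_v f) z| <= L.
  elim=> [|v e' [L L0 HL]]; first by exists 0.
  have [M M0 HM] := IH _ (bounded_derivs_derive v bf).
  exists (M + L); first exact: addr_ge0.
  move=> s w; rewrite in_cons => /orP[/eqP ->|we] sn se z.
    by rewrite (le_trans (HM _ sn se z))// lerDl.
  by rewrite (le_trans (HL _ _ we sn se z))// lerDr.
exact.
Qed.

Lemma is_derive_line E F (f : E -> F) v w (t : R) : smooth f ->
  is_derive t 1 (fun t : R => f (t *: v + w)) ('D_v f (t *: v + w)).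
Proof.
move=> sf; have dl : differentiable (fun t : R => t *: v + w) t.
  apply: differentiableD; last exact: differentiable_cst.
  exact: differentiableZl.
have df := sf [::] (t *: v + w).
apply: DeriveDef; first by apply/diff_derivable/(differentiable_comp dl df).
rewrite -[LHS]/('D_1 (f \o (fun t : R => t *: v + w)) t).
rewrite deriveE; last exact: (differentiable_comp dl df).
rewrite diff_comp//= -(deriveE _ dl) [RHS]deriveE//; congr ('d f _ _).
rewrite -[X in 'D_1 X t]/(( *:%R^~ v) \+ cst w) deriveD.
- by rewrite derive_cst addr0 (derive_diff _ (is_diff_scalel t v)) scale1r.
- by apply: diff_derivable; exact: differentiableZl.
- by apply: diff_derivable; exact: differentiable_cst.
Qed.

(** Mean value theorem along the segment from w to z. Values are real, as that theorem requires;
    vector fields are treated componentwise in [lipschitz_plane]. *)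
Lemma lipschitz_segment E (f : E -> R) z w K : smooth f ->
  (forall x, `|'D_(z - w) f x| <= K) -> `|f z - f w| <= K.
Proof.
move=> sf HK; pose h (t : R) := f (t *: (z - w) + w).
have dh (t : R) : is_derive t 1 h ('D_(z - w) f (t *: (z - w) + w)).
  exact: is_derive_line.
have hc : {within `[0, 1], continuous h}.
  apply: continuous_subspaceT => t; apply: differentiable_continuous.
  by apply/derivable1_diffP; apply: ex_derive; exact: dh.
have [c _] := MVT ltr01 (fun t _ => dh t) hc.
by rewrite /h scale1r subrK scale0r add0r subr0 mulr1 => ->.
Qed.

Lemma smooth_flat (p : {poly R}) : smooth (flat p).
Proof.
apply: (@smooth_coind _ _ _ (fun f => exists p, f = flat p)); last by exists p.
move=> _ [{}p ->]; split=> [z|v].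
  by apply/derivable1_diffP; apply: ex_derive; exact: is_derive_flat.
(* A direction v in R is a scalar and is absorbed into the polynomial. *)
exists (v *: ('X^2 * (p - p^`()))); apply/funext => z.
have dz : differentiable (flat p) z.
  by apply/derivable1_diffP; apply: ex_derive; exact: is_derive_flat.
rewrite -[v in LHS]mulr1 -[v * 1]/(v *: 1) deriveZv//.
rewrite (@derive_val _ _ _ _ _ _ _ (is_derive_flat p z)).
by rewrite /flat; case: ifP => _; rewrite -[LHS]/(v * _) ?mulr0// hornerZ mulrA.
Qed.

(* For x >= 1 the inner argument is nonpositive since exp (-1/x) >= exp (-1). *)
Definition step (x : R) : R := expR 1 * flat 1 (1 - expR 1 * flat 1 x).

Lemma flat1_1 : flat 1 (1 : R) = expR (-1).
Proof. by rewrite flat_pos// hornerC mul1r invr1. Qed.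

Lemma step_eq1 x : x <= 0 -> step x = 1.
Proof.
by move=> x0; rewrite /step (flat_neg _ x0) mulr0 subr0 flat1_1 expRxMexpNx_1.
Qed.

Lemma step_eq0 x : 1 <= x -> step x = 0.
Proof.
move=> x1; have x0 : 0 < x by exact: lt_le_trans x1.
rewrite /step (@flat_neg _ _ (1 - _)) ?mulr0// subr_le0 flat_pos// hornerC mul1r.
by rewrite -expRD -[leLHS]expR0 ler_expR subr_ge0 invf_le1.
Qed.

Lemma smooth_step : smooth step.
Proof.
have s1 k : smooth (fun x : R => k) := @smooth_cst R R R k.
apply: (@smoothM _ _ (fun=> expR 1)) => //.
apply: (@smooth_comp1 _ _ (flat 1) (fun x => 1 - expR 1 * flat 1 x)).
  exact: smooth_flat.
apply: (@smoothD R R R (fun=> 1) (fun x : R => - (expR 1 * flat 1 x))) => //.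
have := @smoothZ R R R (- expR 1) _ (smooth_flat 1).
by under eq_fun do rewrite -[_ *: _]/(_ * _) mulNr.
Qed.

(** The argument y^2 - 1 is at most 0 for |y| <= 1 and at least 3 for |y| >= 2, the two ranges where
    [step] is constant. *)
Definition cutoff (y : R) : R := step (y ^+ 2 - 1).

Lemma cutoff_eq1 y : `|y| <= 1 -> cutoff y = 1.
Proof.
by move=> y1; rewrite /cutoff step_eq1// subr_le0 -real_normK ?num_real// expr_le1.
Qed.

Lemma cutoff_eq0 y : 2 <= `|y| -> cutoff y = 0.
Proof.
move=> y2; rewrite /cutoff step_eq0// -real_normK ?num_real//.
have : 2 ^+ 2 <= `|y| ^+ 2 by rewrite lerXn2r// ?nnegrE.
by lra.
Qed.

Lemma smooth_cutoff : smooth cutoff.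
Proof.
apply: (@smooth_comp1 R R step (fun y : R => y ^+ 2 - 1)).
  exact: smooth_step.
apply: (@smoothD R R R (fun y : R => y ^+ 2) (fun=> -1)); last exact: smooth_cst.
by apply: smoothX; exact: smooth_id.
Qed.

End SmoothMore.

(** * Periodization and the radial vortex *)

Section Locality.
Variable R : realType.
Implicit Types E F G : normedModType R.

(** Base case of the locality of differentiability: for a zero germ, the zero map satisfies the
    little-o expansion that defines the differential. *)
Lemma differentiable_near0 E F (f : E -> F) z :
  (\forall w \near z, f w = 0) -> differentiable f z.
Proof.
move=> f0.
have fo : f \o shift z = cst (f z) + (0 : E -> F) +o_ (0 : E) id.
  rewrite (nbhs_singleton f0); apply/eqaddoP => _/posnumP[e].
  have : \forall w \near (0 : E), f (w + z) = 0.
    have := f0; rewrite (near_shift (0 : E)); apply: filterS => w /=.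
    by rewrite subr0.
  apply: filterS => w /= fw0.
  by rewrite !fctE /= fw0 !addr0 subrr normr0 mulr_ge0.
have d0 : 'd f z = 0 :> (E -> F) by apply: (@diff_unique _ E F f (\0 : {linear E -> F}) z) => //; exact: cst_continuous.
by apply/diff_locallyP; rewrite d0; split => //; exact: cst_continuous.
Qed.

Lemma differentiable_near E F (f g : E -> F) z :
  {near z, f =1 g} -> differentiable g z -> differentiable f z.
Proof.
move=> fg dg; have -> : f = (fun w => f w - g w) + g.
  by apply/funext => w; rewrite fctE subrK.
apply: differentiableD => //; apply: differentiable_near0.
by apply: filterS fg => w ->; rewrite subrr.
Qed.

End Locality.

Section Periodize.
Variable R : realType.
Local Notation P := (R * R)%type.

(** 2 pi times the integer nearest to x / (2 pi), so that x - [winding x] is the representative of x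
    modulo 2 pi in [-pi, pi). *)
Definition winding (x : R) : R := 2 * pi * (Num.floor ((x + pi) / (2 * pi)))%:~R.

(* The function f restricted to |x| <= pi, extended 2 pi-periodically. *)
Definition periodize (F : Type) (f : P -> F) (z : P) : F :=
  f (z - (winding z.1, 0)).

Lemma winding_itv x : - pi <= x - winding x < pi.
Proof.
have p0 : 0 < 2 * pi :> R by rewrite mulr_gt0// pi_gt0.
rewrite /winding; have /andP[] := Num.Theory.real_floor_itv (num_real ((x + pi) / (2 * pi))).
rewrite ler_pdivlMr// ltr_pdivrMr// intrD; move: (_%:~R) => k *.
by apply/andP; split; lra.
Qed.

Lemma windingD x : winding (x + 2 * pi) = winding x + 2 * pi.
Proof.
have p0 : 2 * pi != 0 :> R by rewrite mulf_neq0// gt_eqF// pi_gt0.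
rewrite /winding (_ : (x + 2 * pi + pi) / (2 * pi) = (x + pi) / (2 * pi) + 1%:~R).
  by rewrite floorDrz ?intr_int// intrKfloor intrD mulrDr mulr1.
by rewrite addrAC mulrDl divff.
Qed.

Lemma periodize_xperiodic (F : Type) (f : P -> F) : xperiodic (periodize f).
Proof.
move=> x y; rewrite /periodize /= windingD; congr f.
by apply: injective_projections => /=; ring.
Qed.

Section Derivatives.
Variable F : normedModType R.
Variable f : P -> F.
Hypothesis f0 : forall z : P, 1 <= `|z.1| -> f z = 0.

(** Within distance 1 of z0 the translation may jump, but only by at least 2 pi; then both
    translated abscissas have absolute value at least pi - 1 >= 1, where f vanishes. *)
Lemma periodize_near (z0 : P) :
  {near z0, periodize f =1 fun z => f (z - (winding z0.1, 0))}.
Proof.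
have p2 : 2 <= pi :> R := pi_ge2 R.
near=> z; have : `|z.1 - z0.1| < 1.
  near: z; have : (fst z) @[z --> z0] --> z0.1 by exact: continuous_fst.
  move=> /cvgr_dist_lt/(_ 1 ltr01); apply: filterS => z.
  by rewrite distrC.
rewrite ltr_norml => /andP[zl zr].
rewrite /periodize; have [->//|ne] := eqVneq (winding z.1) (winding z0.1).
have /andP[w1 w2] := winding_itv z.1; have /andP[w3 w4] := winding_itv z0.1.
have : 2 * pi <= `|winding z.1 - winding z0.1|.
  move: ne; rewrite /winding.
  move: (Num.floor _) (Num.floor ((z0.1 + _) / _)) => a b ab.
  rewrite -mulrBr -intrB normrM ger0_norm ?mulr_ge0 ?pi_ge0//.
  rewrite ler_peMr ?mulr_ge0 ?pi_ge0// -intr_norm -[1]/(1%:~R) ler_int.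
  rewrite -gtz0_ge1 normr_gt0 subr_eq0; apply: contra ab => /eqP -> //.
rewrite ler_normr => /orP[] h; rewrite !f0//= ler_normr; apply/orP; lra.
Unshelve. all: by end_near. Qed.

Hypothesis sf : smooth f.

Lemma Dseq_periodize s : Dseq s (periodize f) = periodize (Dseq s f).
Proof.
apply/funext => z; rewrite (Dseq_near _ (periodize_near z)).
by rewrite Dseq_shift.
Qed.

Lemma smooth_periodize : smooth (periodize f).
Proof.
move=> s z; apply: (@differentiable_near _ _ _ _ (Dseq s (fun w => f (w - (winding z.1, 0))))).
  have : \forall w \near z, {near w, periodize f =1 fun z' => f (z' - (winding z.1, 0))}.
    exact/nbhs_interior/periodize_near.
  by apply: filterS => w wn; exact: Dseq_near.
by have := @smooth_shift _ _ _ f (winding z.1, 0) sf s z.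
Qed.

End Derivatives.

End Periodize.

Section Vortex.
Variable R : realType.
Local Notation P := (R * R)%type.
Implicit Types (w : P -> P) (q : P -> R).

(** The equations hold on the whole plane, so dilation and periodization involve no boundary. *)
Record steady_flow w q : Prop := SteadyFlow {
  sf_smooth : smooth w;
  sf_smooth_p : smooth q;
  sf_div : forall z, (dx w z).1 + (dy w z).2 = 0;
  sf_momentum : forall z,
    (w z).1 *: dx w z + (w z).2 *: dy w z = - (dx q z, dy q z)
}.

Lemma derive_fst (v z : P) : 'D_v fst z = v.1.
Proof.
have := @derive_affine R P R (@fst R R) 0 v z (@continuous_fst R R R).
by under eq_fun do rewrite addr0.
Qed.

Lemma derive_snd (v z : P) : 'D_v snd z = v.2.
Proof.
have := @derive_affine R P R (@snd R R) 0 v z (@continuous_snd R R R).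
by under eq_fun do rewrite addr0.
Qed.

(* The velocity gamma (-y, x), with gamma a function of s = x^2 + y^2, satisfies
   w . grad w = - gamma^2 (x, y), so the pressure is a primitive in s of
   gamma^2 / 2.  For gamma = exp (-1/r) / r, r = 1/4 - s, this primitive is
   explicit and vanishes with gamma. *)
Definition vortex_arg (z : P) : R := 4^-1 - (z.1 * z.1 + z.2 * z.2).
Definition vortex_rate (z : P) : R := flat 'X (vortex_arg z).
Definition vortex (z : P) : P := (- (z.2 * vortex_rate z), z.1 * vortex_rate z).
Definition vortex_pressure (z : P) : R := - 4^-1 * (flat 1 (vortex_arg z) * flat 1 (vortex_arg z)).

Lemma smooth_vortex_arg : smooth vortex_arg.
Proof.
have sf := @smooth_fst R R R; have ss := @smooth_snd R R R.
apply: (@smoothD R P R (fun=> 4^-1) (fun z : P => - (z.1 * z.1 + z.2 * z.2))).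
  exact: smooth_cst.
have := @smoothZ R P R (-1) _ (smoothD (smoothM sf sf) (smoothM ss ss)).
by under eq_fun do rewrite scaleN1r.
Qed.

Lemma derive_vortex_arg v z :
  'D_v vortex_arg z = - 2 * (z.1 * v.1 + z.2 * v.2).
Proof.
have sf := @smooth_fst R R R; have ss := @smooth_snd R R R.
have dff : derivable (fst * fst : P -> R) z v.
  by apply: smooth_derivable; exact: smoothM.
have dss : derivable (snd * snd : P -> R) z v.
  by apply: smooth_derivable; exact: smoothM.
have -> : vortex_arg = cst (4^-1) - (fst * fst + snd * snd) by [].
rewrite (deriveB (@derivable_cst _ _ _ _ _ _) (derivableD dff dss)).
rewrite derive_cst (deriveD dff dss).
have df : derivable fst z v by exact: smooth_derivable.
have ds : derivable snd z v by exact: smooth_derivable.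
rewrite (deriveM df df) (deriveM ds ds) derive_fst derive_snd.
by rewrite -![_ *: _]/(_ * _); ring.
Qed.

Lemma smooth_vortex_rate : smooth vortex_rate.
Proof. exact: (smooth_comp1 (smooth_flat 'X) smooth_vortex_arg). Qed.

Lemma derive_vortex_rate v z : 'D_v vortex_rate z =
  - 2 * (z.1 * v.1 + z.2 * v.2) * 'D_1 (flat 'X) (vortex_arg z).
Proof.
rewrite (@derive_comp1 _ _ (flat 'X) vortex_arg).
- by rewrite derive_vortex_arg.
- exact: smooth_differentiable (@smooth_flat R 'X).
- exact: smooth_differentiable smooth_vortex_arg.
Qed.

Lemma smooth_vortex1 : smooth (fun z : P => - (z.2 * vortex_rate z)).
Proof.
have ss := @smooth_snd R R R.
have := @smoothZ R P R (-1) _ (smoothM ss smooth_vortex_rate).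
by under eq_fun do rewrite scaleN1r.
Qed.

Lemma smooth_vortex2 : smooth (fun z : P => z.1 * vortex_rate z).
Proof. exact: smoothM (@smooth_fst R R R) smooth_vortex_rate. Qed.

Lemma smooth_vortex : smooth vortex.
Proof. exact: smooth_pair smooth_vortex1 smooth_vortex2. Qed.

Lemma smooth_vortex_pressure : smooth vortex_pressure.
Proof.
have sg : smooth (fun z => flat 1 (vortex_arg z)) :=
  smooth_comp1 (@smooth_flat R 1) smooth_vortex_arg.
exact: (@smoothZ R P R _ _ (smoothM sg sg)).
Qed.

Lemma derive_vortex v z : 'D_v vortex z =
  (- (v.2 * vortex_rate z + z.2 * 'D_v vortex_rate z),
   v.1 * vortex_rate z + z.1 * 'D_v vortex_rate z).
Proof.
rewrite -[LHS]/(Dseq [:: v] vortex z) Dseq_pair/=; last 2 first.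
- exact: smooth_vortex1.
- exact: smooth_vortex2.
have sr := smooth_vortex_rate.
congr pair.
  rewrite -[LHS]/('D_v (- (snd * vortex_rate)) z) deriveN; last first.
    by apply: smooth_derivable; exact: smoothM (@smooth_snd R R R) sr.
  rewrite deriveM ?derive_snd; try exact: smooth_derivable.
    by rewrite -![_ *: _]/(_ * _); ring.
  by apply: smooth_derivable; exact: smooth_snd.
rewrite -[LHS]/('D_v (fst * vortex_rate) z) deriveM ?derive_fst; try exact: smooth_derivable.
  by rewrite -![_ *: _]/(_ * _); ring.
by apply: smooth_derivable; exact: smooth_fst.
Qed.

Lemma derive_vortex_pressure v z : 'D_v vortex_pressure z =
  (z.1 * v.1 + z.2 * v.2) * vortex_rate z ^+ 2.
Proof.
have s1 := @smooth_flat R 1.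
have sg : smooth (fun z => flat 1 (vortex_arg z)) := smooth_comp1 s1 smooth_vortex_arg.
rewrite -[LHS]/('D_v (- 4^-1 *: ((fun z => flat 1 (vortex_arg z)) * (fun z => flat 1 (vortex_arg z)))) z).
rewrite deriveZ; last by apply: smooth_derivable; exact: (smoothM sg sg).
rewrite deriveM; try exact: smooth_derivable sg.
rewrite (@derive_comp1 _ _ (flat 1) vortex_arg); last 2 first.
- exact: smooth_differentiable s1.
- exact: smooth_differentiable smooth_vortex_arg.
rewrite derive_vortex_arg (@derive_val _ _ _ _ _ _ _ (is_derive_flat 1 (vortex_arg z))).
rewrite -![_ *: _]/(_ * _) /vortex_rate.
(* The squared rate exp(-2/r) / r^2 is exp(-1/r) times its own derivative in r. *)
have -> : flat 'X (vortex_arg z) ^+ 2 = flat 1 (vortex_arg z) * flat ('X^2 * (1 - 1^`())) (vortex_arg z).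
  rewrite /flat; case: ifP => _; last by rewrite mulr0 expr0n.
  by rewrite -[1^`()]/(1%:P^`()) derivC subr0 mulr1 hornerX hornerXn hornerC; ring.
by field.
Qed.

Lemma vortex_steady : steady_flow vortex vortex_pressure.
Proof.
split.
- exact: smooth_vortex.
- exact: smooth_vortex_pressure.
- by move=> z; rewrite /dx /dy !derive_vortex !derive_vortex_rate /=; ring.
- move=> z; rewrite /dx /dy !derive_vortex !derive_vortex_pressure !derive_vortex_rate.
  by apply: injective_projections; rewrite /= -![_ *: _]/(_ * _) /=; ring.
Qed.

Lemma vortex_eq0 z : 2^-1 <= `|z.1| \/ 2^-1 <= `|z.2| ->
  vortex z = 0 /\ vortex_pressure z = 0.
Proof.
move=> H; have : vortex_arg z <= 0.
  rewrite /vortex_arg; have s1 := sqr_ge0 z.1; have s2 := sqr_ge0 z.2.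
  case: H => H.
    have : 2^-1 ^+ 2 <= `|z.1| ^+ 2 by rewrite lerXn2r// nnegrE.
    by rewrite real_normK ?num_real//; lra.
  have : 2^-1 ^+ 2 <= `|z.2| ^+ 2 by rewrite lerXn2r// nnegrE.
  by rewrite real_normK ?num_real//; lra.
move=> H0; rewrite /vortex /vortex_pressure /vortex_rate !flat_neg//.
by rewrite !mulr0 oppr0.
Qed.

Lemma bounded_vortex : bounded_derivs vortex.
Proof.
apply: (@compact_support_bounded R P P vortex ([set` `[(-1 : R), 1]] `*` [set` `[(-1 : R), 1]])).
- exact: smooth_vortex.
- by apply: compact_setX; exact: segment_compact.
- move=> z nz; apply: (vortex_eq0 _).1.
  have [h1|h1] := leP 2^-1 `|z.1|; first by left.
  have [h2|h2] := leP 2^-1 `|z.2|; first by right.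
  exfalso; apply: nz; rewrite /setX /= !in_itv/= -!ler_norml.
  by split; lra.
Qed.

End Vortex.

(** * Hoelder norms *)

Section Norms.
Variable R : realType.
Local Notation P := (R * R)%type.

Definition axes : seq P := [:: (1, 0); (0, 1)].

Definition axis_word i j : seq P := nseq i (1, 0) ++ nseq j (0, 1).

Lemma partialE (F : normedModType R) i j (f : P -> F) :
  partial i j f = Dseq (axis_word i j) f.
Proof.
rewrite /axis_word Dseq_cat /partial.
have -> : iter j (@dy R F) f = Dseq (nseq j ((0, 1) : P)) f.
  by elim: j => //= j ->.
by elim: i => //= i ->.
Qed.

Lemma axes_word i j : {subset axis_word i j <= axes}.
Proof.
move=> v; rewrite mem_cat !mem_nseq /axes !inE.
by case/orP => /andP[_ ->]; rewrite ?orbT.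
Qed.

Lemma size_word i j : size (axis_word i j) = (i + j)%N.
Proof. by rewrite size_cat !size_nseq. Qed.

Lemma pair_normE (z : P) : `|z| = Num.max `|z.1| `|z.2|.
Proof. by []. Qed.

Lemma derive_axes_le (f : P -> P) K x v : differentiable f x ->
    `|'D_((1, 0) : P) f x| <= K -> `|'D_((0, 1) : P) f x| <= K ->
  `|'D_v f x| <= 2 * K * `|v|.
Proof.
move=> df K1 K2.
have vE : v = v.1 *: (1, 0) + v.2 *: (0, 1).
  by apply: injective_projections; rewrite /= -![_ *: _]/(_ * _) /=; ring.
rewrite {1}vE deriveDv// (deriveZv v.1 ((1, 0) : P) df) (deriveZv v.2 ((0, 1) : P) df).
have normZ (a : R) (u : P) : `|u| <= K -> `|a| <= `|v| -> `|a *: u| <= K * `|v|.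
  by move=> uK av; rewrite normrZ mulrC ler_pM.
apply: (le_trans (ler_normD _ _)); rewrite -mulrA mulr_natl mulr2n.
have v1 : `|v.1| <= `|v| by rewrite (pair_normE v) le_max lexx.
have v2 : `|v.2| <= `|v| by rewrite (pair_normE v) le_max lexx orbT.
by apply: lerD; [exact: (normZ _ _ K1 v1)|exact: (normZ _ _ K2 v2)].
Qed.

(** The mean value bound applies to each real component, and the norm is the maximum of the two. The
    factor 2 comes from splitting the direction along the axes. *)
Lemma lipschitz_plane (f : P -> P) K z w : smooth f ->
    (forall x v, v \in axes -> `|'D_v f x| <= K) ->
  `|f z - f w| <= 2 * K * `|z - w|.
Proof.
move=> sf HK; have [v vE] : exists v, v = z - w by exists (z - w).
rewrite -vE.
have HD x : `|'D_v f x| <= 2 * K * `|v|.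
  apply: derive_axes_le; first exact: smooth_differentiable.
    by apply: HK; rewrite !inE eqxx.
  by apply: HK; rewrite !inE eqxx orbT.
rewrite [leLHS]pair_normE ge_max; apply/andP; split.
  have s1 := smooth_compl (L := @fst R R) (@continuous_fst _ R R) sf.
  apply: (lipschitz_segment s1) => x; rewrite -vE.
  have -> : 'D_v (fun z => (f z).1) x = ('D_v f x).1.
    by have := Dseq_compl [:: v] (L := @fst R R) (@continuous_fst _ R R) sf; move=> /(congr1 (@^~ x)).
  by apply: le_trans (HD x); rewrite (pair_normE ('D_v f x)) le_max lexx.
have s1 := smooth_compl (L := @snd R R) (@continuous_snd _ R R) sf.
apply: (lipschitz_segment s1) => x; rewrite -vE.
have -> : 'D_v (fun z => (f z).2) x = ('D_v f x).2.
  by have := Dseq_compl [:: v] (L := @snd R R) (@continuous_snd _ R R) sf; move=> /(congr1 (@^~ x)).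
by apply: le_trans (HD x); rewrite (pair_normE ('D_v f x)) le_max lexx orbT.
Qed.

Definition Ck_terms (k : nat) : R :=
  \sum_(i < k.+1) \sum_(j < k.+1 | (i + j <= k)%N) 1.

Lemma Ck_terms_ge0 k : 0 <= Ck_terms k.
Proof. by apply: sumr_ge0 => i _; apply: sumr_ge0. Qed.

Lemma sup_norm_le (F : normedModType R) (f : P -> F) B :
  (forall z, `|f z| <= B) -> (sup_norm f <= B%:E)%E.
Proof. by move=> HB; apply: ge_ereal_sup => _ [z _ <-]; rewrite lee_fin. Qed.

Lemma Ck_norm_le (F : normedModType R) k (f : P -> F) B :
    (forall s, (size s <= k)%N -> {subset s <= axes} ->
      forall z, `|Dseq s f z| <= B) ->
  (Ck_norm k f <= (Ck_terms k * B)%:E)%E.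
Proof.
move=> HB; rewrite /Ck_norm /Ck_terms mulr_suml -sumEFin.
apply: lee_sum => i _; rewrite mulr_suml -sumEFin; apply: lee_sum => j ij.
rewrite mul1r; apply: sup_norm_le => z; rewrite partialE; apply: HB.
  by rewrite size_word.
exact: axes_word.
Qed.

(* An increment is at most 2 K min(delta, |z - w|), which is bounded by
   2 K delta^(1-a) |z - w|^a. *)
Lemma holder_seminorm_le (f : P -> P) a delta K : 0 < a < 1 -> 0 < delta ->
    smooth f -> (forall z, `|f z| <= K * delta) ->
    (forall z v, v \in axes -> `|'D_v f z| <= K) ->
  (holder_seminorm a f <= (2 * K * delta `^ (1 - a))%:E)%E.
Proof.
move=> /andP[a0 a1] d0 sf H0 H1; apply: ge_ereal_sup => _ [z [w [_ _ zw ->]]].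
have K0 : 0 <= K by apply: le_trans (H1 z (1, 0) _); rewrite ?inE ?eqxx.
have r0 : 0 < `|z - w| by rewrite normr_gt0 subr_eq0.
rewrite lee_fin ler_pdivrMr ?powR_gt0//.
have splitE (x : R) : 0 < x -> x `^ (1 - a) * x `^ a = x.
  by move=> x0; rewrite -powRD ?subrK ?powRr1 ?ltW// gt_eqF// implybT.
have [rd|dr] := leP `|z - w| delta.
  apply: (le_trans (lipschitz_plane z w sf H1)).
  rewrite -[X in _ * X <= _](splitE _ r0) mulrA ler_wpM2r ?powR_ge0//.
  by rewrite ler_wpM2l ?mulr_ge0// ge0_ler_powR ?nnegrE ?subr_ge0// ltW.
apply: (@le_trans _ _ (2 * K * delta)).
  by rewrite (le_trans (ler_normB _ _))// -mulrA mulr_natl mulr2n lerD.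
rewrite -[X in _ * X <= _](splitE _ d0) mulrA ler_wpM2l//.
  by rewrite !mulr_ge0// powR_ge0.
by rewrite ge0_ler_powR ?nnegrE// ltW.
Qed.

(** Up to order k there is a gain of a factor delta, at order k + 1 none; interpolation leaves
    delta^(1-a) for the Hoelder seminorms. *)
Lemma holder_norm_le k (f : P -> P) a delta K : 0 < a < 1 -> 0 < delta <= 1 ->
    smooth f ->
    (forall s, (size s <= k)%N -> {subset s <= axes} ->
      forall z, `|Dseq s f z| <= K * delta) ->
    (forall s, size s = k.+1 -> {subset s <= axes} ->
      forall z, `|Dseq s f z| <= K) ->
  (holder_norm k a f <= ((Ck_terms k + k.+1%:R) * (2 * K * delta `^ (1 - a)))%:E)%E.
Proof.
move=> a01 /andP[d0 d1] sf Hlow Htop.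
(* As delta <= 1, the lower-order terms fit under the same power of delta. *)
have dd : delta <= delta `^ (1 - a).
  by rewrite ger1_powR ?d0// lerBlDr lerDl ltW//; case/andP: a01.
have K0 : 0 <= K.
  rewrite -(pmulr_lge0 _ d0); apply: le_trans (Hlow [::] _ _ 0) => //.
have lowB s z : (size s <= k)%N -> {subset s <= axes} ->
    `|Dseq s f z| <= 2 * K * delta `^ (1 - a).
  move=> sk sa; apply: (le_trans (Hlow _ sk sa z)).
  rewrite -mulrA mulr_natl mulr2n; apply: (@le_trans _ _ (K * delta `^ (1 - a))).
    by rewrite ler_wpM2l.
  by rewrite lerDl mulr_ge0// powR_ge0.
rewrite mulrDl EFinD; apply: leeD.
  by apply: Ck_norm_le => s sk sa z; exact: lowB.
have -> : k.+1%:R * (2 * K * delta `^ (1 - a)) =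
    \sum_(i < k.+1) (2 * K * delta `^ (1 - a)).
  by rewrite sumr_const card_ord mulr_natl.
rewrite -sumEFin; apply: lee_sum => i _; rewrite partialE.
have sz : size (axis_word i (k - i)) = k.
  by rewrite size_word subnKC// -ltnS.
apply: holder_seminorm_le => //.
- exact: smooth_Dseq.
- by move=> z; apply: Hlow; rewrite ?sz//; exact: axes_word.
- move=> z v va; apply: (Htop (v :: _)); rewrite /= ?sz//.
  by move=> w; rewrite inE => /orP[/eqP ->//|]; exact: axes_word.
Qed.

End Norms.

(** * The travelling vortices *)

Section SteadyFlow.
Variable R : realType.
Local Notation P := (R * R)%type.
Implicit Types (w : P -> P) (q : P -> R).

Lemma derive_dilate (F : normedModType R) (f : P -> F) (a k : R) v z : smooth f ->
  'D_v (fun z => a *: f (k *: z)) z = (a * k) *: 'D_v f (k *: z).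
Proof.
move=> sf; rewrite -[LHS]/(Dseq [:: v] (fun z => a *: f (k *: z)) z).
by rewrite (DseqZ _ _ (smooth_dilate k sf)) (Dseq_dilate _ _ sf) /= expr1 scalerA.
Qed.

(** The transport term and the pressure gradient are both multiplied by a^2 k. *)
Lemma steady_dilate w q (a k : R) : steady_flow w q ->
  steady_flow (fun z => a *: w (k *: z)) (fun z => a ^+ 2 *: q (k *: z)).
Proof.
case=> sw sq hdiv hmom; split.
- exact: smoothZ (smooth_dilate k sw).
- exact: smoothZ (smooth_dilate k sq).
- move=> z; rewrite /dx /dy !derive_dilate//=.
  by rewrite -mulrDr hdiv mulr0.
- move=> z; rewrite /dx /dy !derive_dilate//=.
  have := hmom (k *: z); rewrite /dx /dy.
  move: ('D__ w _) ('D__ w _) ('D__ q _) ('D__ q _) (w _).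
  move=> [b1 b2] [a1 a2] p2 p1 [w1 w2] e.
  have p1E : p1 = - (w1 * a1 + w2 * b1) by have /= -> := congr1 fst e; rewrite opprK.
  have p2E : p2 = - (w1 * a2 + w2 * b2) by have /= -> := congr1 snd e; rewrite opprK.
  rewrite p1E p2E; apply: injective_projections; rewrite /= -![_ *: _]/(_ * _) /=; ring.
Qed.

Lemma steady_periodize w q : (forall z : P, 1 <= `|z.1| -> w z = 0 /\ q z = 0) ->
  steady_flow w q -> steady_flow (periodize w) (periodize q).
Proof.
move=> wq0 [sw sq hdiv hmom].
have w0 z : 1 <= `|z.1| -> w z = 0 by move/wq0 => [].
have q0 z : 1 <= `|z.1| -> q z = 0 by move/wq0 => [].
have Dw v z : 'D_v (periodize w) z = 'D_v w (z - (winding z.1, 0)) :=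
  congr1 (@^~ z) (Dseq_periodize w0 sw [:: v]).
have Dq v z : 'D_v (periodize q) z = 'D_v q (z - (winding z.1, 0)) :=
  congr1 (@^~ z) (Dseq_periodize q0 sq [:: v]).
split.
- exact: smooth_periodize.
- exact: smooth_periodize.
- by move=> z; rewrite /dx /dy !Dw; exact: hdiv.
- by move=> z; rewrite /dx /dy !Dw !Dq; exact: hmom.
Qed.

End SteadyFlow.

Section Flow.
Variable R : realType.
Local Notation P := (R * R)%type.
Variables (n N : nat) (c : 'I_N -> R) (delta : R).

Definition eddy : P -> P :=
  periodize (fun z => delta ^+ n *: vortex (delta^-1 *: z)).
Definition eddy_pressure : P -> R :=
  periodize (fun z => (delta ^+ n) ^+ 2 *: vortex_pressure (delta^-1 *: z)).

(** In the variable y / delta, band i is centred at 4 i. Each cutoff reaches to distance 2, so the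
    spacing 4 keeps them from overlapping. *)
Definition plateaus (y : R) : R :=
  \sum_(i < N) cutoff (y - 4 * i%:R) * (c i - y ^+ n).
Definition profile (y : R) : R := y ^+ n + delta ^+ n * plateaus (delta^-1 * y).

(** The bands have half-width delta; delta (4 N + 1) <= 1 keeps all of them inside the channel. *)
Definition level (i : 'I_N) : R := 4 * i%:R * delta.
Definition eddy_center (theta : 'rV[R]_N) (i : 'I_N) : P := (theta 0 i, level i).

(** Parametrized by the vortex positions instead of time, so that the same map also serves as the
    continuous map on the N-torus. *)
Definition flow (theta : 'rV[R]_N) (z : P) : P :=
  (profile z.2, 0) + \sum_(i < N) eddy (z - eddy_center theta i).
Definition flow_pressure (theta : 'rV[R]_N) (z : P) : R :=
  \sum_(i < N) eddy_pressure (z - eddy_center theta i).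

Hypothesis d0 : 0 < delta.
Hypothesis dN : delta * (4 * N%:R + 1) <= 1.

Let d1 : delta <= 1.
Proof.
apply: le_trans dN; rewrite -[leLHS]mulr1 ler_pM2l//.
by rewrite lerDr mulr_ge0.
Qed.

Lemma dilated_eq0 (z : P) : delta / 2 <= `|z.1| \/ delta / 2 <= `|z.2| ->
  vortex (delta^-1 *: z) = 0 /\ vortex_pressure (delta^-1 *: z) = 0.
Proof.
move=> H; apply: vortex_eq0.
have E x : delta / 2 <= `|x| -> 2^-1 <= `|delta^-1 * x|.
  by rewrite normrM (gtr0_norm (x := delta^-1)) ?invr_gt0// ler_pdivlMl.
by case: H => /E; [left|right].
Qed.

Lemma dilated_supp (z : P) : 1 <= `|z.1| ->
  delta ^+ n *: vortex (delta^-1 *: z) = 0 /\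
  (delta ^+ n) ^+ 2 *: vortex_pressure (delta^-1 *: z) = 0.
Proof.
move=> z1; have [|-> ->] := @dilated_eq0 z; last by rewrite !scaler0.
by left; apply: le_trans z1; move: d0 d1; lra.
Qed.

Lemma eddy_steady : steady_flow eddy eddy_pressure.
Proof.
apply: steady_periodize; first exact: dilated_supp.
exact: (steady_dilate _ _ (vortex_steady R)).
Qed.

Lemma eddy_eq0 (z : P) : delta / 2 <= `|z.2| -> eddy z = 0 /\ eddy_pressure z = 0.
Proof.
move=> z2; rewrite /eddy /eddy_pressure /periodize.
have [|-> ->] := @dilated_eq0 (z - (winding z.1, 0)); last by rewrite !scaler0.
by right; rewrite /= subr0.
Qed.

Lemma smooth_plateaus : smooth plateaus.
Proof.
apply: (@smooth_sum R R R) => i.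
apply: (@smoothM R R (fun y : R => cutoff (y - 4 * i%:R)) (fun y : R => c i - y ^+ n)).
  exact: (@smooth_shift R R R _ _ (@smooth_cutoff R)).
apply: (@smoothD R R R (fun=> c i) (fun y : R => - y ^+ n)); first exact: smooth_cst.
have := @smoothZ R R R (-1) _ (@smoothX R R _ n (@smooth_id R R)).
by under eq_fun do rewrite scaleN1r.
Qed.

Lemma smooth_profile : smooth profile.
Proof.
apply: (@smoothD R R R (fun y : R => y ^+ n)); first exact: smoothX (@smooth_id R R).
exact: (@smoothZ R R R _ _ (smooth_dilate delta^-1 smooth_plateaus)).
Qed.

Lemma level_dist (i j : 'I_N) : i != j -> 4 * delta <= `|level i - level j|.
Proof.
move=> ij; rewrite /level -mulrBl -mulrBr normrM (gtr0_norm d0) ler_pM2r//.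
rewrite normrM ger0_norm// ler_peMr//.
have : (1 <= `|(i : int) - (j : int)|)%R by rewrite -gtz0_ge1 normr_gt0 subr_eq0.
by rewrite -(ler_int R) intr_norm intrB.
Qed.

(** By homogeneity delta^n (y / delta)^n = y^n, so the cutoff equal to 1 removes y^n exactly. The
    other cutoffs vanish, their centres being at distance at least 3 from y / delta. *)
Lemma profile_plateau i y : `|y - level i| <= delta -> profile y = delta ^+ n * c i.
Proof.
move=> yi; rewrite /profile /plateaus.
have scale (j : 'I_N) : delta^-1 * y - 4 * j%:R = delta^-1 * (y - level j).
  by rewrite /level; field; rewrite gt_eqF.
rewrite (bigD1 i)//= big1 ?addr0 => [|j ji].
  rewrite cutoff_eq1 ?mul1r.
    rewrite mulrBr exprMn mulrA -exprMn divff ?gt_eqF// expr1n mul1r.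
    by rewrite addrC subrK.
  rewrite scale normrM (gtr0_norm (x := delta^-1)) ?invr_gt0//.
  by rewrite ler_pdivrMl// mulr1.
rewrite cutoff_eq0 ?mul0r// scale normrM (gtr0_norm (x := delta^-1)) ?invr_gt0//.
rewrite ler_pdivlMl//.
have := level_dist ji; have := ler_normD (level i - y) (y - level j).
rewrite addrA subrK (distrC (level i) y) (distrC (level j)) => h1 h2.
move: d0; lra.
Qed.

(* [flow_band] and [flow_shear] describe the germ of the flow on two open sets
   that cover the plane, which reduces the Euler equations to those of a single
   vortex in a uniform stream and of a shear flow. *)
Lemma flow_band i theta z : `|z.2 - level i| < delta ->
  flow theta z = (delta ^+ n * c i, 0) + eddy (z - eddy_center theta i) /\
  flow_pressure theta z = eddy_pressure (z - eddy_center theta i).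
Proof.
move=> zi; have far j : j != i -> delta / 2 <= `|(z - eddy_center theta j).2|.
  rewrite /= => ji; have := level_dist ji.
  have := ler_normD (level i - z.2) (z.2 - level j).
  rewrite addrA subrK (distrC (level i) z.2) (distrC (level j)) => h1 h2.
  by move: zi d0; lra.
rewrite /flow /flow_pressure (profile_plateau (ltW zi)).
rewrite (bigD1 i)//= big1 ?addr0 => [|j /far /eddy_eq0 []//].
by rewrite (bigD1 i)//= big1 ?addr0// => j /far /eddy_eq0 [].
Qed.

Lemma flow_shear theta z : (forall i, delta / 2 <= `|z.2 - level i|) ->
  flow theta z = (profile z.2, 0) /\ flow_pressure theta z = 0.
Proof.
move=> far; rewrite /flow /flow_pressure !big1 ?addr0// => i _.
- by have [] := @eddy_eq0 (z - eddy_center theta i) (far i).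
- by have [] := @eddy_eq0 (z - eddy_center theta i) (far i).
Qed.

Lemma near_band i (z : P) : `|z.2 - level i| < delta ->
  \forall w \near z, `|w.2 - level i| < delta.
Proof.
move=> zi; pose e := delta - `|z.2 - level i|; have e0 : 0 < e by rewrite subr_gt0.
have : (snd w) @[w --> z] --> z.2 by exact: continuous_snd.
move=> /cvgr_dist_lt/(_ e e0); apply: filterS => w.
rewrite /e distrC => h.
have := ler_normD (w.2 - z.2) (z.2 - level i); rewrite addrA subrK; lra.
Qed.

(** The vortices have radius delta / 2, half that of the bands; this margin extends the shear
    description to a neighbourhood of the closed complement of the bands. *)
Lemma near_shear (z : P) : (forall i, delta <= `|z.2 - level i|) ->
  \forall w \near z, forall i, delta / 2 <= `|w.2 - level i|.
Proof.
move=> far; have e0 : 0 < delta / 2 by rewrite divr_gt0.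
have : (snd w) @[w --> z] --> z.2 by exact: continuous_snd.
move=> /cvgr_dist_lt/(_ _ e0); apply: filterS => w h i.
have := ler_normD (z.2 - w.2) (w.2 - level i); rewrite addrA subrK.
by have := far i; lra.
Qed.

Lemma derive_profile v (z : P) :
  'D_v (fun z : P => (profile z.2, 0) : P) z = (v.2 * 'D_1 profile z.2, 0).
Proof.
have ss := @smooth_snd R R R.
have sp := smooth_comp1 smooth_profile ss.
rewrite -[LHS]/(Dseq [:: v] (fun z : P => (profile z.2, cst 0 z)) z).
rewrite (Dseq_pair _ sp (@smooth_cst R P R 0)).
rewrite /= derive_cst (@derive_comp1 _ _ profile snd); last 2 first.
- exact: smooth_differentiable smooth_profile.
- exact: smooth_differentiable ss.
by rewrite derive_snd.
Qed.

End Flow.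

Lemma derive_translate (R : realType) (E F : normedModType R) v (f : E -> F) b z :
  smooth f -> 'D_v (fun w => f (w - b)) z = 'D_v f (z - b).
Proof.
by move=> sf; rewrite -[LHS]/(Dseq [:: v] (fun w => f (w - b)) z) Dseq_shift.
Qed.

Section Euler.
Variable R : realType.
Local Notation P := (R * R)%type.
Variables (n N : nat) (c : 'I_N -> R) (delta : R).
Hypothesis d0 : 0 < delta.
Hypothesis dN : delta * (4 * N%:R + 1) <= 1.

Local Notation eddy := (eddy n delta).
Local Notation eddy_pressure := (eddy_pressure n delta).
Local Notation level := (level delta).
Local Notation eddy_center := (eddy_center delta).
Local Notation flow := (flow n c delta).
Local Notation flow_pressure := (flow_pressure n delta).
Local Notation profile := (profile n c delta).

Lemma smooth_shear_profile : smooth (fun z : P => (profile z.2, 0) : P).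
Proof.
apply: smooth_pair (@smooth_cst R P R 0).
exact: (smooth_comp1 (smooth_profile n c delta) (@smooth_snd R R R)).
Qed.

Lemma smooth_flow theta : smooth (flow theta).
Proof.
have [se _ _ _] := eddy_steady n d0 dN.
apply: (smoothD smooth_shear_profile).
by apply: (@smooth_sum R P P) => i; exact: smooth_shift.
Qed.

Lemma flow_cases (z : P) :
  (exists i : 'I_N, `|z.2 - level i| < delta) \/ (forall i : 'I_N, delta <= `|z.2 - level i|).
Proof.
have [?|/forallNP h] := pselect (exists i : 'I_N, `|z.2 - level i| < delta); first by left.
by right=> i; rewrite leNgt; apply/negP; exact: h.
Qed.

Lemma derive_flow_band (i : 'I_N) theta v z : `|z.2 - level i| < delta ->
  'D_v (flow theta) z = 'D_v eddy (z - eddy_center theta i) /\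
  'D_v (flow_pressure theta) z = 'D_v eddy_pressure (z - eddy_center theta i).
Proof.
move=> zi; have [se sq _ _] := eddy_steady n d0 dN; have nz := near_band zi.
split.
  rewrite (@derive_near _ _ _ _ _ (fun w => cst (delta ^+ n * c i, 0) w + eddy (w - eddy_center theta i))).
    rewrite -[LHS]/(Dseq [:: v] (fun w => cst (delta ^+ n * c i, 0) w + eddy (w - eddy_center theta i)) z).
    rewrite (DseqD _ (smooth_cst _) (smooth_shift (eddy_center theta i) se)).
    rewrite /= derive_cst add0r.
    exact: derive_translate.
  by apply: filterS nz => w wi; have [->] := flow_band n c d0 theta wi.
rewrite (@derive_near _ _ _ _ _ (fun w => eddy_pressure (w - eddy_center theta i))).
  exact: derive_translate.
by apply: filterS nz => w wi; have [_ ->] := flow_band n c d0 theta wi.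
Qed.

Lemma derive_flow_shear theta v z : (forall i : 'I_N, delta <= `|z.2 - level i|) ->
  'D_v (flow theta) z = (v.2 * 'D_1 profile z.2, 0) /\
  'D_v (flow_pressure theta) z = 0.
Proof.
move=> far; have nz := near_shear d0 far; split.
  rewrite -derive_profile; apply: derive_near.
  by apply: filterS nz => w wf; have [->] := flow_shear n c d0 theta wf.
rewrite (@derive_near _ _ _ _ _ (cst 0)) ?derive_cst//.
by apply: filterS nz => w wf; have [_ ->] := flow_shear n c d0 theta wf.
Qed.

Lemma eddy_xperiodic : xperiodic eddy.
Proof. exact: periodize_xperiodic. Qed.

Lemma flow_velocity_field theta : velocity_field (flow theta).
Proof.
have [se sq hdiv hmom] := eddy_steady n d0 dN.
split.
- exact: smooth_flow.
- move=> x y; congr (_ + _); apply: eq_bigr => i _.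
  rewrite (_ : (x + 2 * pi, y) - _ = (x - theta 0 i + 2 * pi, y - level i)).
    exact: eddy_xperiodic.
  by apply: injective_projections => /=; ring.
- move=> z _; rewrite /dx /dy; have [[i zi]|far] := flow_cases z.
    rewrite (derive_flow_band theta ((1, 0) : P) zi).1 (derive_flow_band theta ((0, 1) : P) zi).1.
    exact: hdiv.
  rewrite (derive_flow_shear theta ((1, 0) : P) far).1 (derive_flow_shear theta ((0, 1) : P) far).1.
  by rewrite /= mul0r addr0.
(* The walls avoid all vortices: the levels lie between 0 and 4 (N - 1) delta, and 4 N delta + delta
   <= 1. *)
- have far (x y : R) : `|y| = 1 -> (flow theta (x, y)).2 = 0.
    move=> y1; have [i|-> //] := @flow_shear _ n _ c _ d0 theta (x, y).
    have lN : level i <= 4 * (N%:R - 1) * delta.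
      rewrite /level ler_pM2r// ler_pM2l// lerBrDr -(natrD _ _ 1) ler_nat addn1.
      exact: ltn_ord.
    have l0 : 0 <= level i by rewrite /level !mulr_ge0// ltW.
    have := ler_normD (y - level i) (level i); rewrite subrK y1 (ger0_norm l0) /=.
    by move: dN d0; lra.
  by move=> x; split; apply: far; rewrite ?normrN normr1.
Qed.

Definition phase (t : R) : 'rV[R]_N := \row_i (delta ^+ n * c i * t).

(** The travelling translate is f composed with an affine map of space-time, which gives joint
    smoothness in time and space. *)
Lemma smooth_travelling (F : normedModType R) (f : P -> F) (a b : R) : smooth f ->
  smooth (fun q : R * P => f (q.2 - (a * q.1, b))).
Proof.
move=> sf.
pose L (q : R * P) : P := q.2 - q.1 *: (a, 0).
have Llin : linear L.
  move=> k [x1 y1] [x2 y2]; rewrite /L /=.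
  by apply: injective_projections; rewrite /= -![_ *: _]/(_ * _) /=; ring.
pose LM := GRing.isLinear.Build _ _ _ _ _ Llin.
pose L' : {linear (R * P)%type -> P} := HB.pack L LM.
have Lc : continuous L'.
  move=> q; apply: cvgB; first exact: cvg_snd.
  by apply: cvgZr_tmp; exact: cvg_fst.
have := smooth_affine (L := L') (- (0, b)) Lc sf.
congr smooth; apply/funext => q; congr f; rewrite /L' /= /L.
by apply: injective_projections; rewrite /= -![_ *: _]/(_ * _) /=; ring.
Qed.

Lemma is_derive_travelling (F : normedModType R) (f : P -> F) z (a b t : R) : smooth f ->
  is_derive t 1 (fun s => f (z - (a * s, b))) ((- a) *: 'D_((1, 0) : P) f (z - (a * t, b))).
Proof.
move=> sf.
have -> : (fun s => f (z - (a * s, b))) = fun s => f (s *: (- a, 0) + (z - (0, b))).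
  by apply/funext => s; congr f; apply: injective_projections; rewrite /= -![_ *: _]/(_ * _) /=; ring.
have := is_derive_line (- a, 0) (z - (0, b)) t sf; congr is_derive.
rewrite -deriveZv; last exact: smooth_differentiable.
have -> : (- a) *: ((1, 0) : P) = (- a, 0).
  by apply: injective_projections; rewrite /= -![_ *: _]/(_ * _) /=; ring.
have -> // : t *: ((- a, 0) : P) + (z - (0, b)) = z - (a * t, b).
by apply: injective_projections; rewrite /= -![_ *: _]/(_ * _) /=; ring.
Qed.

Lemma center_phase t i : eddy_center (phase t) i = (delta ^+ n * c i * t, level i).
Proof. by rewrite /eddy_center mxE. Qed.

Lemma flow_euler : euler_solution (fun t => flow (phase t)).
Proof.
have [se sq hdiv hmom] := eddy_steady n d0 dN.
exists (fun t => flow_pressure (phase t)); split.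
- rewrite /flow; apply: (@smoothD R (R * P)%type P).
    have sp := smooth_comp1 (smooth_profile n c delta) (@smooth_snd R R R).
    apply: (@smooth_pair R (R * P)%type R R); last exact: smooth_cst.
    apply: (@smooth_comp1 R (R * P)%type profile (fun q => q.2.2)).
      exact: smooth_profile.
    exact: smooth_compl (@continuous_snd _ R R) (@smooth_snd R R P).
  apply: (@smooth_sum R (R * P)%type P) => i.
  under eq_fun do rewrite center_phase.
  exact: smooth_travelling.
- apply: (@smooth_sum R (R * P)%type R) => i.
  under eq_fun do rewrite center_phase.
  exact: smooth_travelling.
- by move=> t; exact: flow_velocity_field.
- move=> t x y; apply: eq_bigr => i _; rewrite center_phase.
  rewrite (_ : (x + 2 * pi, y) - _ = (x - delta ^+ n * c i * t + 2 * pi, y - level i)).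
    exact: periodize_xperiodic.
  by apply: injective_projections => /=; ring.
- move=> t z _; rewrite derive1E /dx /dy; have [[i zi]|far] := flow_cases z.
    (* In a band, transport by the uniform stream delta^n c_i cancels the time derivative; the
       steady equation of the eddy remains. *)
    have bx := derive_flow_band (phase t) ((1, 0) : P) zi.
    have by_ := derive_flow_band (phase t) ((0, 1) : P) zi.
    rewrite bx.1 bx.2 by_.1 by_.2 (flow_band n c d0 (phase t) zi).1.
    have -> : (fun s => flow (phase s) z) =
        (fun s => cst (delta ^+ n * c i, 0) s + eddy (z - (delta ^+ n * c i * s, level i))).
      by apply/funext => s; rewrite (flow_band n c d0 (phase s) zi).1 center_phase.
    rewrite (@derive_val _ _ _ _ _ _ _ (is_deriveD (is_derive_cst _ _ _)
      (is_derive_travelling z (delta ^+ n * c i) (level i) t se))).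
    rewrite center_phase /= !add0r scalerDl scaleNr -addrA addKr.
    by have := hmom (z - (delta ^+ n * c i * t, level i)); exact.
  (* Off the bands the flow is locally a stationary shear with zero pressure, so every term of the
     equation vanishes. *)
  have half (i : 'I_N) : delta / 2 <= `|z.2 - level i| by have := far i; move: d0; lra.
  have bx := derive_flow_shear (phase t) ((1, 0) : P) far.
  have by_ := derive_flow_shear (phase t) ((0, 1) : P) far.
  rewrite bx.1 bx.2 by_.1 by_.2 (flow_shear n c d0 (phase t) half).1.
  have -> : (fun s => flow (phase s) z) = cst (profile z.2, 0).
    by apply/funext => s; rewrite (flow_shear n c d0 (phase s) half).1.
  rewrite derive_cst /=.
  by apply: injective_projections; rewrite /= -![_ *: _]/(_ * _) /=; ring.
Qed.

End Euler.

(** * Closeness to the power shear in the Hoelder norm *)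

Section Smallness.
Variable R : realType.
Local Notation P := (R * R)%type.

Lemma bounded_plateaus n N (c : 'I_N -> R) : bounded_derivs (plateaus n c).
Proof.
(* The centres are at most 4 (N - 1), and each cutoff reaches to distance 2. *)
pose B : R := 4 * N%:R + 2.
apply: (@compact_support_bounded R R R (plateaus n c) [set` `[- B, B]]).
- exact: smooth_plateaus.
- exact: segment_compact.
- move=> y nB; apply: big1 => i _; rewrite cutoff_eq0 ?mul0r//.
  have iN : i%:R + 1 <= N%:R :> R by rewrite -(natrD _ _ 1) ler_nat addn1.
  have i0 : 0 <= i%:R :> R by [].
  have [yB|yB] := leP y B.
    rewrite ler_normr; apply/orP; right; have : y < - B.
      by rewrite ltNge; apply/negP => By; apply: nB; rewrite /= in_itv/= By yB.
    by rewrite /B; lra.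
  by rewrite ler_normr; apply/orP; left; move: yB; rewrite /B; lra.
Qed.

Definition plateau_field n N (c : 'I_N -> R) (z : P) : P := (plateaus n c z.2, 0).

Lemma smooth_plateau_field n N (c : 'I_N -> R) : smooth (plateau_field n c).
Proof.
apply: smooth_pair (@smooth_cst R P R 0).
exact: (smooth_comp1 (smooth_plateaus n c) (@smooth_snd R R R)).
Qed.

Lemma bounded_plateau_field n N (c : 'I_N -> R) : bounded_derivs (plateau_field n c).
Proof.
move=> s; have [K HK] := bounded_plateaus n c (map snd s).
exists K => z.
have sp := smooth_comp1 (smooth_plateaus n c) (@smooth_snd R R R).
rewrite (Dseq_pair s sp (@smooth_cst R P R 0)) Dseq_cst0.
have -> : Dseq s (fun z : P => plateaus n c z.2) z = Dseq (map snd s) (plateaus n c) z.2.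
  have := Dseq_affine (L := @snd R R) 0 s (@continuous_snd _ R R) (smooth_plateaus n c).
  under eq_fun do rewrite addr0.
  by move=> ->; rewrite addr0.
rewrite pair_normE /= normr0 max_l//; exact: HK.
Qed.

Lemma Dseq_dilated (F : normedModType R) (f : P -> F) s (a k : R) z : smooth f ->
  Dseq s (fun z => a *: f (k *: z)) z = (a * k ^+ size s) *: Dseq s f (k *: z).
Proof.
by move=> sf; rewrite (DseqZ _ _ (smooth_dilate k sf)) (Dseq_dilate _ _ sf) scalerA.
Qed.

Lemma Dseq_eddy n (delta : R) s (z : P) : 0 < delta <= 1 ->
  Dseq s (eddy n delta) z = (delta ^+ n * delta^-1 ^+ size s) *:
     Dseq s (@vortex R) (delta^-1 *: (z - (winding z.1, 0))).
Proof.
move=> /andP[d0 d1]; have sv := @smooth_vortex R.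
(* The eddy does not depend on N, and for N = 0 the size condition reads delta <= 1. *)
have dN : delta * (4 * 0%:R + 1) <= 1 by rewrite mulr0 add0r mulr1.
rewrite /eddy Dseq_periodize.
- exact: Dseq_dilated.
- by move=> w w1; have [] := dilated_supp n d0 dN w1.
- exact: smoothZ (smooth_dilate _ sv).
Qed.

Lemma smooth_eddy n (delta : R) : 0 < delta <= 1 -> smooth (@eddy R n delta).
Proof.
move=> /andP[d0 d1]; have dN : delta * (4 * 0%:R + 1) <= 1.
  by rewrite mulr0 add0r mulr1.
by have [] := eddy_steady n d0 dN.
Qed.

Lemma bounded_eddy n (delta : R) : 0 < delta <= 1 -> bounded_derivs (@eddy R n delta).
Proof.
move=> d01 s; have [K HK] := @bounded_vortex R s.
exists (`|delta ^+ n * delta^-1 ^+ size s| * K) => z.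
by rewrite Dseq_eddy// normrZ ler_wpM2l//; exact: HK.
Qed.

Lemma flow_perturbation n N (c : 'I_N -> R) delta theta :
  (flow n c delta theta \- @power_shear R n)%R =
  (fun z => delta ^+ n *: plateau_field n c (delta^-1 *: z) +
    \sum_(i < N) eddy n delta (z - eddy_center delta theta i)).
Proof.
apply/funext => z; rewrite /= /flow /power_shear addrAC; congr (_ + _).
apply: injective_projections; rewrite /= -?[_ *: _]/(_ * _) /= /profile ?mulr0 ?subrr//.
by rewrite addrAC subrr add0r.
Qed.

(** Each derivative costs a factor 1 / delta against the amplitude delta^n. K comes from the
    unscaled plateau field and vortex, so it is fixed before delta and theta. *)
Lemma flow_perturbation_bound n N (c : 'I_N -> R) : exists2 K, 0 <= K &
  forall delta theta s z, 0 < delta <= 1 -> (size s <= n)%N ->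
    {subset s <= axes R} ->
    `|Dseq s (flow n c delta theta \- @power_shear R n)%R z| <= K * delta ^+ (n - size s).
Proof.
have [K1 K10 HK1] := bounded_derivs_uniform (axes R) n (bounded_plateau_field n c).
have [K2 K20 HK2] := bounded_derivs_uniform (axes R) n (@bounded_vortex R).
exists (K1 + N%:R * K2); first by rewrite addr_ge0// mulr_ge0.
move=> delta theta s z d01 sn sa; have /andP[d0 d1] := d01.
have sp := smooth_plateau_field n c; have se := smooth_eddy n d01.
have dE : delta ^+ n * delta^-1 ^+ size s = delta ^+ (n - size s).
  by rewrite exprVn -expfB_cond// gt_eqF.
have dn0 : 0 <= delta ^+ (n - size s) by rewrite exprn_ge0// ltW.
rewrite flow_perturbation.
have s1 : smooth (fun z => delta ^+ n *: plateau_field n c (delta^-1 *: z)).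
  exact: smoothZ (smooth_dilate _ sp).
have s2 i : smooth (fun z => eddy n delta (z - eddy_center delta theta i)).
  exact: smooth_shift.
rewrite (DseqD s s1 (smooth_sum _ s2)) (Dseq_sum _ s s2).
rewrite (Dseq_dilated s _ _ _ sp) dE mulrDl.
apply: (le_trans (ler_normD _ _)); apply: lerD.
  rewrite normrZ (ger0_norm dn0) mulrC ler_wpM2r//; exact: HK1.
apply: (le_trans (ler_norm_sum _ _ _)).
rewrite -mulrA mulr_natl -[X in _ *+ X](card_ord N) -sumr_const.
apply: ler_sum => i _; rewrite (Dseq_shift s _ se) (Dseq_eddy n s _ d01) dE.
by rewrite normrZ (ger0_norm dn0) mulrC ler_wpM2r//; exact: HK2.
Qed.

Lemma flow_close n N (c : 'I_N -> R) eps alpha : (1 <= n)%N -> 0 < eps ->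
    0 < alpha < 1 ->
  exists delta, [/\ 0 < delta, delta * (4 * N%:R + 1) <= 1 &
    forall theta, (holder_norm n.-1 alpha
      (flow n c delta theta \- @power_shear R n)%R < eps%:E)%E].
Proof.
move=> n1 e0 a01; have /andP[a0 a1] := a01.
have [K K0 HK] := flow_perturbation_bound n c.
(* The Hoelder norm is at most (M - 1) delta^(1 - alpha); the added 1 makes M positive and the final
   inequality strict. *)
pose M := (Ck_terms R n.-1 + n.-1.+1%:R) * (2 * K) + 1.
have M0 : 0 < M.
  by rewrite ltr_wpDl// mulr_ge0// ?addr_ge0 ?Ck_terms_ge0// mulr_ge0.
(* The solution of r^(1 - alpha) = eps / M. *)
pose r := (eps / M) `^ ((1 - alpha)^-1).
have r0 : 0 < r by apply: powR_gt0; exact: divr_gt0.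
have N0 : 0 < 4 * N%:R + 1 :> R by rewrite ltr_wpDl// mulr_ge0.
pose delta := Num.min r (4 * N%:R + 1)^-1.
have d0 : 0 < delta by rewrite lt_min r0 invr_gt0.
have dN : delta * (4 * N%:R + 1) <= 1.
  by rewrite -ler_pdivlMr// div1r ge_min lexx orbT.
have d1 : 0 < delta <= 1.
  rewrite d0 /=; apply: le_trans dN; rewrite -[leLHS]mulr1 ler_pM2l//.
  by rewrite lerDr mulr_ge0.
exists delta; split => // theta.
have sf : smooth (flow n c delta theta \- @power_shear R n)%R.
  rewrite flow_perturbation; apply: smoothD.
    exact: smoothZ (smooth_dilate _ (smooth_plateau_field n c)).
  by apply: smooth_sum => i; apply: smooth_shift; exact: smooth_eddy.
apply: (@le_lt_trans _ _ ((Ck_terms R n.-1 + n.-1.+1%:R) * (2 * K * delta `^ (1 - alpha)))%:E).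
  (* Orders up to n - 1 leave at least one factor delta; order n leaves delta^0 = 1. *)
  apply: holder_norm_le => //.
  - move=> s sn sa z; apply: (le_trans (HK _ _ _ _ d1 _ sa)).
      by apply: leq_trans sn _; exact: leq_pred.
    apply: ler_wpM2l => //; rewrite -[leRHS]expr1.
    apply: ler_wiXn2l; [exact: ltW|by case/andP: d1|].
    by rewrite subn_gt0 (leq_ltn_trans sn)// prednK.
  - move=> s sn sa z; apply: (le_trans (HK _ _ _ _ d1 _ sa)).
      by rewrite sn prednK.
    by rewrite sn prednK// subnn mulr1.
rewrite lte_fin mulrA; apply: (@le_lt_trans _ _ ((M - 1) * (eps / M))).
  rewrite /M addrK ler_wpM2l ?mulr_ge0 ?addr_ge0 ?Ck_terms_ge0//.
  have -> : eps / M = r `^ (1 - alpha).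
    by rewrite /r -powRrM mulVf ?powRr1 ?divr_ge0 ?ltW// gt_eqF// subr_gt0.
  apply: ge0_ler_powR; rewrite ?nnegrE; [by rewrite subr_ge0 ltW|exact: ltW|exact: ltW|].
  by rewrite ge_min lexx.
rewrite mulrCA -[ltRHS]mulr1 ltr_pM2l// ltr_pdivrMr// mul1r.
by rewrite ltrBlDr ltrDl.
Qed.

End Smallness.

(** * Detecting a vortex at a point; non-shear form and continuity on the torus *)

Section Probe.
Variable R : realType.
Local Notation P := (R * R)%type.

Lemma cos_ge1B (u : R) : 1 - `|u| <= cos u.
Proof.
rewrite -cos_norm; move: `|u| (normr_ge0 u) => {}u u0.
have hc : {within `[0, u], continuous (@cos R)}.
  by apply: continuous_subspaceT; exact: continuous_cos.
have [x _] := MVT_segment u0 (fun x _ => is_derive_cos x) hc.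
rewrite cos0 subr0 => h; have := ler_piMl u0 (sin_le1 x); move: h; rewrite mulNr; lra.
Qed.

Lemma winding_eq0 (x : R) : - pi <= x < pi -> winding x = 0.
Proof.
move=> /andP[x1 x2]; have p0 := pi_gt0 R.
rewrite /winding (@floor_def _ _ 0) ?mulr0//.
rewrite add0r ler_pdivlMr ?ltr_pdivrMr ?mulr_gt0// mul0r mul1r.
by apply/andP; split; lra.
Qed.

Lemma cosDz (x : R) (k : int) : cos (x + 2 * pi * k%:~R) = cos x.
Proof.
have cosM y (m : nat) : cos (y + 2 * pi * m%:R) = cos y.
  elim: m => [|m IH]; first by rewrite mulr0 addr0.
  rewrite -[RHS]IH -[RHS]cosD2pi; congr cos.
  by rewrite -natr1 -mulr_natl; ring.
case: k => m; first exact: cosM.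
by rewrite NegzE mulrNz mulrN -[in RHS](subrK (2 * pi * m.+1%:R) x) cosM.
Qed.

Lemma cos_winding (x : R) : cos (x - winding x) = cos x.
Proof. by rewrite -[LHS](cosDz _ (Num.floor ((x + pi) / (2 * pi)))) subrK. Qed.

Variables (n N : nat) (c : 'I_N -> R) (delta : R).
Hypothesis d0 : 0 < delta.
Hypothesis dN : delta * (4 * N%:R + 1) <= 1.

Let d1 : delta <= 1.
Proof.
apply: le_trans dN; rewrite -[leLHS]mulr1 ler_pM2l//.
by rewrite lerDr mulr_ge0.
Qed.

(** Undilated, the point is (1/4, 0), inside the disc of radius 1/2 that carries the vortex; the
    rotation points upwards there. *)
Lemma eddy_gt0 : 0 < (eddy n delta (delta / 4, 0)).2.
Proof.
have p2 := pi_ge2 R.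
rewrite /eddy /periodize winding_eq0; last by apply/andP; move: d0 d1; split => /=; lra.
have -> : delta^-1 *: ((delta / 4, 0) - ((0, 0) : P)) = (4^-1, 0).
  apply: injective_projections; rewrite /= -![_ *: _]/(_ * _) /= subr0 ?mulr0//.
  by rewrite mulrA mulVf ?gt_eqF// mul1r.
apply: mulr_gt0; rewrite ?exprn_gt0//= /vortex_rate mulr_gt0//.
have h : 0 < vortex_arg ((4^-1, 0) : P) by rewrite /vortex_arg /=; lra.
by rewrite flat_pos// hornerX mulr_gt0 ?expR_gt0 ?invr_gt0.
Qed.

(* At the point (delta/4, 0) the vortex is felt only for phases phi with
   |phi| < 3 delta/4 modulo 2 pi, where cos phi >= 1/4. *)
Lemma eddy_far phi : cos phi < 4^-1 -> eddy n delta (delta / 4 - phi, 0) = 0.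
Proof.
move=> cphi; rewrite /eddy /periodize /=.
set x := delta / 4 - phi.
have [|-> _] := @dilated_eq0 R delta d0 ((x, 0) - (winding x, 0)); last by rewrite scaler0.
left; rewrite /= leNgt; apply/negP => hx.
have : cos phi = cos (delta / 4 - (x - winding x)).
  rewrite -[LHS](cosDz _ (Num.floor ((x + pi) / (2 * pi)))); congr cos.
  by rewrite -/(winding x) /x; ring.
move=> e; have := cos_ge1B (delta / 4 - (x - winding x)); rewrite -e.
have := ler_normB (delta / 4) (x - winding x).
have -> : `|delta / 4| = delta / 4 by rewrite gtr0_norm// divr_gt0.
by move: cphi hx d0 d1; lra.
Qed.

(** The shear part has no vertical component, so the vertical velocity here sees vortex i alone:
    positive at phase 0, zero once the cosine of the phase is below 1/4. *)
Definition probe (i : 'I_N) : P := (delta / 4, level delta i).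

Lemma level_itv (i : 'I_N) : 0 <= level delta i <= 1.
Proof.
apply/andP; split; first by rewrite /level !mulr_ge0// ltW.
apply: le_trans dN; rewrite /level mulrC ler_pM2l//.
apply: (@le_trans _ _ (4 * N%:R)); last by rewrite lerDl.
by rewrite ler_pM2l// ler_nat ltnW.
Qed.

Lemma strip_level (x : R) (i : 'I_N) : strip (x, level delta i).
Proof. by have /andP[h0 h1] := level_itv i; rewrite /strip /=; apply/andP; split; lra. Qed.

Lemma flow_probe theta x i : (flow n c delta theta (x, level delta i)).2 =
  (eddy n delta (x - theta 0 i, 0)).2.
Proof.
have [|-> _] := @flow_band R n N c delta d0 i theta (x, level delta i).
  by rewrite /= subrr normr0.
rewrite [in LHS]/= add0r (_ : _ - eddy_center _ _ _ = (x - theta 0 i, 0))//.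
by apply: injective_projections; rewrite //= subrr.
Qed.

Lemma flow_probe_gt0 (theta : 'rV[R]_N) i : theta 0 i = 0 -> 0 < (flow n c delta theta (probe i)).2.
Proof. by move=> t0; rewrite flow_probe t0 subr0; exact: eddy_gt0. Qed.

Lemma flow_probe_eq0 (theta : 'rV[R]_N) i : cos (theta 0 i) < 4^-1 ->
  (flow n c delta theta (probe i)).2 = 0.
Proof. by move=> h; rewrite flow_probe eddy_far. Qed.

Lemma flow_non_shear theta (i : 'I_N) : ~ shear (flow n c delta theta).
Proof.
move=> [v hv].
have := hv (delta / 4 + theta 0 i, level delta i) (strip_level _ i).
move=> /(congr1 snd); rewrite flow_probe addrK => e.
by have := eddy_gt0; rewrite e ltxx.
Qed.

Lemma flow_torus_periodic theta (i : 'I_N) z :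
  flow n c delta (theta + (2 * pi) *: delta_mx 0 i) z = flow n c delta theta z.
Proof.
rewrite /flow; move: (profile _ _ _ _, 0) => u; congr (u + _); apply: eq_bigr => j _.
rewrite /eddy_center !mxE eqxx /=.
case: eqP => [_|_]; last by rewrite mulr0 addr0.
rewrite mulr1.
have -> : z - (theta 0 j, level delta j) =
    ((z - (theta 0 j + 2 * pi, level delta j)).1 + 2 * pi,
     (z - (theta 0 j + 2 * pi, level delta j)).2).
  by apply: injective_projections => /=; ring.
by rewrite [RHS](eddy_xperiodic n delta).
Qed.

(** The profile cancels in the difference. The eddies are merely translated, and their derivatives
    up to order k are Lipschitz because those up to order k + 1 are bounded. *)
Lemma flow_Ck_lipschitz k : exists2 C, 0 <= C & forall theta theta',
  (Ck_norm k (flow n c delta theta' \- flow n c delta theta)%R <=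
    (C * `|theta - theta'|)%:E)%E.
Proof.
have d01 : 0 < delta <= 1 by rewrite d0.
have [K K0 HK] := bounded_derivs_uniform (axes R) k.+1 (bounded_eddy n d01).
exists (Ck_terms R k * (N%:R * (2 * K))).
  by rewrite mulr_ge0 ?Ck_terms_ge0// !mulr_ge0.
move=> theta theta'; rewrite -mulrA; apply: Ck_norm_le => s sk sa z.
have se := smooth_eddy n d01.
have s1 (th : 'rV[R]_N) (i : 'I_N) :
    smooth (fun z => eddy n delta (z - eddy_center delta th i)) by exact: smooth_shift.
have s2 (i : 'I_N) : smooth (fun z => eddy n delta (z - eddy_center delta theta' i) +
    (-1 : R) *: eddy n delta (z - eddy_center delta theta i)).
  by apply: smoothD; [exact: s1|exact: smoothZ (s1 _ _)].
have -> : (flow n c delta theta' \- flow n c delta theta)%R =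
    fun z => \sum_(i < N) (eddy n delta (z - eddy_center delta theta' i) +
    (-1 : R) *: eddy n delta (z - eddy_center delta theta i)).
  apply/funext => w; rewrite /flow /= opprD addrACA subrr add0r -sumrB.
  by apply: eq_bigr => i _; rewrite scaleN1r.
rewrite (Dseq_sum _ s s2); apply: (le_trans (ler_norm_sum _ _ _)).
rewrite -mulrA mulr_natl -[X in _ *+ X](card_ord N) -sumr_const.
apply: ler_sum => i _.
rewrite (DseqD s (s1 theta' i) (smoothZ _ (s1 theta i))) (DseqZ s _ (s1 theta i)).
have shE th : Dseq s (fun z => eddy n delta (z - eddy_center delta th i)) z =
    Dseq s (eddy n delta) (z - eddy_center delta th i).
  by rewrite (Dseq_shift s (eddy_center delta th i) se).
rewrite (shE theta') (shE theta) (scaleN1r (Dseq _ _ _)).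
have HK' x v : v \in axes R -> `|'D_v (Dseq s (eddy n delta)) x| <= K.
  move=> va; apply: (HK (v :: s)) => //.
  by move=> w; rewrite inE => /orP[/eqP ->//|]; exact: sa.
apply: (le_trans (lipschitz_plane _ _ (smooth_Dseq s se) HK')).
apply: ler_wpM2l; first exact: mulr_ge0.
have -> : z - eddy_center delta theta' i - (z - eddy_center delta theta i) =
    ((theta - theta') 0 i, 0).
  by apply: injective_projections => /=; rewrite ?mxE; ring.
rewrite pair_normE /= normr0 max_l//.
rewrite [leRHS]/Num.norm/= mx_normrE.
exact: (le_bigmax _ (fun ij => `|(theta - theta') ij.1 ij.2|) (ord0, i)).
Qed.

Lemma Ck_norm_ge0 (F : normedModType R) k (f : P -> F) : (0 <= Ck_norm k f)%E.
Proof.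
apply: sume_ge0 => i _; apply: sume_ge0 => j _.
apply: (@le_trans _ _ (`|partial i j f 0|)%:E); first by rewrite lee_fin.
by apply: ereal_sup_ubound; exists 0 => //; rewrite /strip /=; apply/andP; split; lra.
Qed.

Lemma flow_torus_map : torus_map (flow n c delta).
Proof.
split.
- by move=> theta i z _; exact: flow_torus_periodic.
- exact: flow_velocity_field.
- move=> k theta; have [C C0 HC] := flow_Ck_lipschitz k.
  have nC : C * `|theta - th| @[th --> theta] --> (0 : R).
    have nt : `|theta - th| @[th --> theta] --> `|theta - theta|.
      have FF : Filter (nbhs theta) := nbhs_filter theta.
      apply/(@cvgrPdist_le _ _ _ (nbhs theta) FF) => e e0; rewrite subrr normr0.
      have := nbhsx_ballx theta e e0; apply: filterS => th.
      by rewrite -ball_normE /ball_ /= sub0r normrN normr_id => /ltW.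
    by have := @cvgMl_tmp _ _ _ (nbhs_filter theta) _ C _ nt; rewrite subrr normr0 mulr0.
  refine (@squeeze_cvge _ (nbhs theta) _ R (fun=> 0%E) _
    (fun th => (C * `|theta - th|)%:E) _ _ _ _).
  + by apply: nearW => th; rewrite Ck_norm_ge0 HC.
  + exact: cvg_cst.
  + by apply: cvg_EFin; [exact: nearW|exact: nC].
Qed.

End Probe.

(** * Kronecker's theorem *)

Section MeanValue.
Variable R : realType.
Implicit Types (f g : R -> R) (a b c : R).

(* Equivalent for our purposes to the mean value lim (1/T) int_0^T f = a: f has
   an antiderivative at bounded distance from the line of slope a. *)
Definition has_mean f a := exists F B,
  (forall t : R, is_derive t 1 F (f t)) /\ forall t, `|F t - a * t| <= B.

Lemma has_meanD f g a b : has_mean f a -> has_mean g b ->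
  has_mean (fun t => f t + g t) (a + b).
Proof.
move=> [F [B [dF hF]]] [G [C [dG hG]]]; exists (F + G), (B + C); split.
  by move=> t; exact: is_deriveD.
move=> t; rewrite mulrDl fctE opprD addrACA.
by apply: (le_trans (ler_normD _ _)); exact: lerD.
Qed.

Lemma has_meanZ k f a : has_mean f a -> has_mean (fun t => k * f t) (k * a).
Proof.
move=> [F [B [dF hF]]]; exists (k *: F), (`|k| * B); split.
  by move=> t; exact: is_deriveZ.
move=> t; rewrite fctE -[k *: _]/(k * _) -mulrA -mulrBr normrM.
by rewrite ler_wpM2l.
Qed.

Lemma has_mean_cst a : has_mean (fun=> a) a.
Proof.
exists (a *: id), 0; split.
  move=> t; have := is_deriveZ a (is_derive_id t (1 : R)).
  by rewrite -[a *: 1]/(a * 1) mulr1.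
by move=> t; rewrite fctE -[a *: _]/(a * _) subrr normr0.
Qed.

Lemma has_mean_cos l : l != 0 -> has_mean (fun t => cos (l * t)) 0.
Proof.
move=> l0; exists (fun t => l^-1 *: sin (l * t)), `|l^-1|; split.
  move=> t; have dl : is_derive t 1 (fun t => l * t) l.
    by have := is_deriveZ l (is_derive_id t (1 : R)); rewrite -[l *: 1]/(l * 1) mulr1.
  have ds : differentiable sin (l * t) by exact/derivable1_diffP/derivable_sin.
  have dl' : differentiable (fun t => l * t) t by apply/derivable1_diffP; apply: ex_derive.
  have d : is_derive t 1 (fun t => sin (l * t)) (l * cos (l * t)).
    apply: DeriveDef; first by apply/derivable1_diffP; exact: (differentiable_comp dl' ds).
    rewrite (derive_comp1 _ ds dl') (@derive_val _ _ _ _ _ _ _ dl).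
    by rewrite (@derive_val _ _ _ _ _ _ _ (is_derive_sin (l * t))).
  have := is_deriveZ l^-1 d; rewrite -[l^-1 *: (l * _)]/(_ * _) mulrA mulVf// mul1r.
  exact.
move=> t; rewrite mul0r subr0 -[_ *: _]/(_ * _) normrM.
by rewrite ler_piMr// sin_max.
Qed.

(** An antiderivative of a nonnegative function is nondecreasing, so it cannot stay at bounded
    distance from a line of negative slope. *)
Lemma has_mean_ge0 f a : (forall t, 0 <= f t) -> has_mean f a -> 0 <= a.
Proof.
move=> f0 [F [B [dF hF]]]; rewrite leNgt; apply/negP => a0.
have B0 : 0 <= B by exact: le_trans (hF 0).
(* At this time the line has dropped by 2 B + 1, more than the total error 2 B. *)
pose t := (2 * B + 1) / (- a).
have t0 : 0 < t by rewrite divr_gt0 ?oppr_gt0// ltr_wpDl// mulr_ge0.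
have hc : {within `[0, t], continuous F}.
  apply: continuous_subspaceT => x; apply: differentiable_continuous.
  by apply/derivable1_diffP; apply: ex_derive.
have [x _] := MVT t0 (fun x _ => dF x) hc; rewrite subr0 => Ft.
have : 0 <= F t - F 0 by rewrite Ft mulr_ge0// ltW.
have := hF t; have := hF 0; rewrite mulr0 subr0 !ler_norml => /andP[h1 h2] /andP[h3 h4].
have : a * t = - (2 * B + 1) by rewrite /t; field; rewrite lt_eqF.
lra.
Qed.

Variable S : R -> Prop.
Hypothesis S0 : S 0.
Hypothesis SD : forall x y, S x -> S y -> S (x + y).
Hypothesis SN : forall x, S x -> S (- x).

(** S is a subgroup of the reals, later the integer span of the given frequencies; l = 0 gives the
    constants. Nonnegative coefficients survive products, which rules out cancellation in mean
    values. *)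
Inductive cos_cone : (R -> R) -> Prop :=
| cone_cos A l : 0 <= A -> S l -> cos_cone (fun t => A * cos (l * t))
| cone_add f g : cos_cone f -> cos_cone g -> cos_cone (fun t => f t + g t).

Lemma cone_cst A : 0 <= A -> cos_cone (fun=> A).
Proof.
move=> A0; have := cone_cos A0 S0.
by under eq_fun do rewrite mul0r cos0 mulr1.
Qed.

Lemma cone_scale k f : 0 <= k -> cos_cone f -> cos_cone (fun t => k * f t).
Proof.
move=> k0; elim=> {f} [A l A0 Sl|f g _ fk _ gk].
  by under eq_fun do rewrite mulrA; apply: cone_cos => //; exact: mulr_ge0.
by under eq_fun do rewrite mulrDr; exact: cone_add.
Qed.

Lemma cos_mul (x y : R) : cos x * cos y = 2^-1 * (cos (x + y) + cos (x - y)).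
Proof. by rewrite cosD cosB; field. Qed.

Lemma cone_mul f g : cos_cone f -> cos_cone g -> cos_cone (fun t => f t * g t).
Proof.
move=> cf; elim=> {g} [A l A0 Sl|g h _ fg _ fh]; last first.
  by under eq_fun do rewrite mulrDr; exact: cone_add.
elim: cf => {f} [B m B0 Sm|f g _ fg _ fh]; last first.
  by under eq_fun do rewrite mulrDl; exact: cone_add.
have -> : (fun t => B * cos (m * t) * (A * cos (l * t))) =
    fun t => B * A / 2 * cos ((m + l) * t) + B * A / 2 * cos ((m - l) * t).
  by apply/funext => t; rewrite mulrACA cos_mul -mulrDl -mulrBl; field.
have BA : 0 <= B * A / 2 by rewrite !mulr_ge0.
by apply: cone_add; apply: cone_cos => //; apply: SD => //; exact: SN.
Qed.

Lemma cone_mean f : cos_cone f -> exists2 a, 0 <= a & has_mean f a.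
Proof.
elim=> {f} [A l A0 _|f g _ [a a0 fa] _ [b b0 gb]].
  have [->|l0] := eqVneq l 0.
    exists A => //; under eq_fun do rewrite mul0r cos0 mulr1.
    exact: has_mean_cst.
  by exists 0 => //; rewrite -(mulr0 A); apply: has_meanZ; exact: has_mean_cos.
by exists (a + b); [exact: addr_ge0|exact: has_meanD].
Qed.

(** The product has the frequencies l + c and l - c, nonzero because l lies in the subgroup S and c
    does not; so no constant term appears. *)
Lemma cone_mul_cos f c : ~ S c -> cos_cone f ->
  has_mean (fun t => f t * cos (c * t)) 0.
Proof.
move=> Sc; elim=> {f} [A l A0 Sl|f g _ hf _ hg]; last first.
  by under eq_fun do rewrite mulrDl; rewrite -(addr0 0); exact: has_meanD.
have -> : (fun t => A * cos (l * t) * cos (c * t)) =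
    fun t => A / 2 * cos ((l + c) * t) + A / 2 * cos ((l - c) * t).
  by apply/funext => t; rewrite -mulrA cos_mul -mulrDl -mulrBl; field.
have lc : l + c != 0.
  apply/eqP => e; apply: Sc; have -> : c = - l by apply/eqP; rewrite -addr_eq0 addrC e.
  exact: SN.
have lc' : l - c != 0 by rewrite subr_eq0; apply/eqP => e; apply: Sc; rewrite -e.
have := has_meanD (has_meanZ (A / 2) (has_mean_cos lc)) (has_meanZ (A / 2) (has_mean_cos lc')).
by rewrite mulr0 addr0.
Qed.

(* The excess g has nonnegative coefficients but may itself contain constants, so
   b is only a lower bound for the mean value of f. *)
Definition cone_above b f := exists2 g, cos_cone g & forall t, f t = b + g t.

Lemma cone_above_mul a b f g : 0 <= a -> 0 <= b ->
  cone_above a f -> cone_above b g -> cone_above (a * b) (fun t => f t * g t).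
Proof.
move=> a0 b0 [f' cf fE] [g' cg gE].
exists (fun t => (a * g' t + b * f' t) + f' t * g' t).
  apply: cone_add; last exact: cone_mul.
  by apply: cone_add; exact: cone_scale.
by move=> t; rewrite fE gE; ring.
Qed.

Lemma sum_binS (K : nat) (b : nat -> R) :
  \sum_(k < K.+2) 'C(K.+1, k)%:R * b k =
  \sum_(k < K.+1) 'C(K, k)%:R * (b k + b k.+1).
Proof.
rewrite big_ord_recl /= bin0.
under eq_bigr => i _ do rewrite /bump /= add1n binS natrD mulrDl.
under [RHS]eq_bigr do rewrite mulrDr.
rewrite !big_split /= addrA; congr (_ + _).
have -> : \sum_(k < K.+1) 'C(K, k)%:R * b k = \sum_(k < K.+2) 'C(K, k)%:R * b k.
  by rewrite [RHS]big_ord_recr /= bin_small// mul0r addr0.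
by rewrite [RHS]big_ord_recl /= bin0.
Qed.

(** Real form of the binomial expansion of (e^(ix) + e^(-ix))^K, by induction from the product
    formula and Pascal's rule. *)
Lemma cos_pow (x : R) K : (2 * cos x) ^+ K =
  \sum_(k < K.+1) 'C(K, k)%:R * cos ((K%:R - 2 * k%:R) * x).
Proof.
elim: K => [|K IH].
  by rewrite big_ord1 expr0 bin0 mul1r mulr0 subrr mul0r cos0.
rewrite (sum_binS K (fun k => cos ((K.+1%:R - 2 * k%:R) * x))) exprS IH mulr_sumr.
apply: eq_bigr => k _; rewrite mulrCA; congr (_ * _).
rewrite -mulrA cos_mul mulrA divff ?mul1r//.
by rewrite -[X in _ = _ + X]cosN; congr (cos _ + cos _); rewrite -!natr1; ring.
Qed.

(* Central coefficient / 4^M = mean value of ((1 + cos t)/2)^M; what matters is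
   that it decays only polynomially in M. *)
Lemma central_bin_ge (M : nat) : (4 ^ M <= 2 * M.+1 * 'C(M.*2, M))%N.
Proof.
elim: M => [//|M IH].
have sym : 'C(M.*2.+1, M) = 'C(M.*2.+1, M.+1).
  have M1 : (M.+1 <= M.*2.+1)%N by rewrite ltnS -addnn leq_addr.
  by rewrite -(bin_sub M1) subSS -addnn addnK.
have E : ('C(M.+1.*2, M.+1) * M.+1 = 2 * (M.*2.+1 * 'C(M.*2, M)))%N.
  rewrite doubleS binS sym addnn -[(_.*2)%N in LHS]mul2n -mulnA; congr (_ * _)%N.
  by rewrite mulnC -mul_bin_diag.
rewrite -(leq_pmul2r (ltn0Sn M)) -mulnA E expnS.
move: IH; move: (4 ^ M)%N 'C(M.*2, M) => q X IH; nia.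
Qed.

Lemma cone_multiple x (k : nat) : S x -> S (k%:R * x).
Proof.
move=> Sx; elim: k => [|k IH]; first by rewrite mul0r.
by rewrite -natr1 mulrDl mul1r; exact: SD.
Qed.

Lemma cone_sum I (r : seq I) (P : pred I) (f : I -> R -> R) :
  (forall i, P i -> cos_cone (f i)) -> cos_cone (fun t => \sum_(i <- r | P i) f i t).
Proof.
move=> cf; elim: r => [|i r IH].
  by under eq_fun do rewrite big_nil; exact: cone_cst.
case Pi: (P i); under eq_fun do rewrite big_cons Pi; last exact: IH.
by apply: cone_add => //; exact: cf.
Qed.

(** The half-angle formula gives cos(w t / 2)^(2 M), with frequencies (M - k) w in S. The term k = M
    is constant and bounded below by [central_bin_ge]. *)
Lemma cone_kernel (M : nat) w : S w ->
  cone_above (2 * M.+1%:R)^-1 (fun t => ((1 + cos (w * t)) / 2) ^+ M).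
Proof.
move=> Sw.
have E t : ((1 + cos (w * t)) / 2) ^+ M =
    \sum_(k < M.*2.+1) 'C(M.*2, k)%:R / 4 ^+ M * cos ((M%:R * w - k%:R * w) * t).
  have -> : (1 + cos (w * t)) / 2 = (2 * cos (w * t / 2)) ^+ 2 / 4.
    have -> : cos (w * t) = cos ((w * t / 2) *+ 2) by congr cos; rewrite -mulr_natl; field.
    by rewrite cos_mulr2n; field.
  rewrite exprMn exprVn -exprM mul2n cos_pow mulr_suml; apply: eq_bigr => k _.
  rewrite mulrAC; congr (_ * cos _).
  have -> : M.*2%:R = M%:R * 2 :> R by rewrite -muln2 natrM.
  by move: (M%:R) (k%:R) => u v; field.
have MM : (M < M.*2.+1)%N by rewrite ltnS -addnn leq_addr.
pose i0 := Ordinal MM.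
pose b : R := 'C(M.*2, M)%:R / 4 ^+ M.
have bM : (2 * M.+1%:R)^-1 <= b.
  rewrite /b ler_pdivlMr ?exprn_gt0// mulrC ler_pdivrMr ?mulr_gt0//.
  rewrite -(natrM _ 2) -natrM -natrX ler_nat mulnC; exact: central_bin_ge.
(* The surplus of the central coefficient over the bound joins the cone as a constant. *)
exists (fun t => (b - (2 * M.+1%:R)^-1) + \sum_(k < M.*2.+1 | k != i0)
    'C(M.*2, k)%:R / 4 ^+ M * cos ((M%:R * w - k%:R * w) * t)).
  apply: cone_add; first by apply: cone_cst; rewrite subr_ge0.
  apply: cone_sum => k _; apply: cone_cos; first by rewrite mulr_ge0// invr_ge0 exprn_ge0.
  by apply: SD; [|apply: SN]; exact: cone_multiple.
move=> t; rewrite E (bigD1 i0)//= subrr mul0r cos0 mulr1 -/b.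
by rewrite addrA addrCA subrr addr0.
Qed.

Lemma cone_kernels (M : nat) (ws : seq R) : (forall w, w \in ws -> S w) ->
  cone_above ((2 * M.+1%:R)^-1 ^+ size ws)
    (fun t => \prod_(w <- ws) ((1 + cos (w * t)) / 2) ^+ M).
Proof.
elim: ws => [_|w ws IH Sw].
  exists (fun=> 0); first exact: cone_cst.
  by move=> t; rewrite big_nil expr0 addr0.
under eq_fun do rewrite big_cons; rewrite exprS.
apply: cone_above_mul; rewrite ?exprn_ge0 ?invr_ge0 ?mulr_ge0//.
  by apply: cone_kernel; apply: Sw; rewrite mem_head.
by apply: IH => v vws; apply: Sw; rewrite in_cons vws orbT.
Qed.

Lemma has_mean_kernels (M : nat) (ws : seq R) c : (forall w, w \in ws -> S w) -> ~ S c ->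
  let p t := \prod_(w <- ws) ((1 + cos (w * t)) / 2) ^+ M in
  exists2 a, (2 * M.+1%:R)^-1 ^+ size ws <= a &
    has_mean p a /\ has_mean (fun t => p t * cos (c * t)) 0.
Proof.
move=> Sws Sc p; have [g cg pE] := cone_kernels M Sws.
have [a a0 ga] := cone_mean cg.
set b := _ ^+ _ in pE *; have b0 : 0 <= b by rewrite exprn_ge0// invr_ge0 mulr_ge0.
exists (b + a); first by rewrite lerDl.
have -> : p = fun t => b + g t by apply/funext => t; exact: pE.
split; first by apply: has_meanD => //; exact: has_mean_cst.
exact: cone_mul_cos (cone_add (cone_cst b0) cg).
Qed.

(** With r = exp(-a), compare exp(a M) with the single term (a M)^(m+1) / (m+1)! of its series. *)
Lemma geometric_beats_power (m : nat) (r : R) : 0 < r < 1 ->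
  exists M : nat, 8 * r ^+ M < (2 * M.+1%:R)^-1 ^+ m.
Proof.
move=> /andP[r0 r1]; pose a := - ln r.
have a0 : 0 < a by rewrite oppr_gt0 ln_lt0// r0.
have rE : r = expR (- a) by rewrite opprK lnK// posrE.
(* Beyond this threshold (a M)^(m+1) / (m+1)! exceeds 8 (4 M)^m, and 2 (M + 1) <= 4 M once M >=
   1. *)
pose C := 8 * 4 ^+ m * (m.+1)`!%:R / a ^+ m.+1.
have C0 : 0 < C.
  by rewrite /C divr_gt0 ?exprn_gt0// !mulr_gt0 ?exprn_gt0// ltr0n fact_gt0.
have [M MC] : exists M : nat, C < M%:R by exists (Num.truncn C).+1; exact: truncnS_gt.
have M0 : 0 < M%:R :> R by exact: lt_trans MC.
have M1 : 1 <= M%:R :> R by rewrite ler1n -(ltr0n R).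
have h1 : 8 * (4 * M%:R) ^+ m < expR (a * M%:R).
  apply: (@lt_le_trans _ _ ((a * M%:R) ^+ m.+1 / (m.+1)`!%:R)); last first.
    apply: le_trans (expR_ge1Dxn m _); first by rewrite lerDr.
    by rewrite mulr_ge0// ltW.
  rewrite ltr_pdivlMr ?ltr0n ?fact_gt0// !exprMn [M%:R ^+ m.+1]exprS.
  move: MC; rewrite /C ltr_pdivrMr ?exprn_gt0// => MC.
  have Mm : 0 < M%:R ^+ m :> R by rewrite exprn_gt0.
  have := MC; rewrite -(ltr_pM2r Mm); congr (_ < _); ring.
have h2 : (2 * M.+1%:R) ^+ m <= (4 * M%:R) ^+ m :> R.
  apply: lerXn2r; rewrite ?nnegrE ?mulr_ge0//.
  by rewrite -natr1; move: M1; lra.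
exists M; rewrite exprVn rE -expRM_natr mulNr expRN.
rewrite ltr_pdivrMr ?expR_gt0// ltr_pdivlMl; last by rewrite exprn_gt0// mulr_gt0.
apply: le_lt_trans h1; rewrite mulrC ler_wpM2l//.
Qed.

Lemma kronecker (ws : seq R) c eta : (forall w, w \in ws -> S w) -> ~ S c ->
    0 < eta <= 1 ->
  exists t, (forall w, w \in ws -> 1 - eta < cos (w * t)) /\ cos (c * t) < 4^-1.
Proof.
move=> Sws Sc /andP[e0 e1]; apply: contrapT => /forallNP noT.
(* The value of (1 + cos) / 2 when the cosine is 1 - eta, so a frequency that misses its target
   bounds the whole product by r^M. *)
pose r := 1 - eta / 2; have r01 : 0 < r < 1 by apply/andP; rewrite /r; lra.
have [M MC] := geometric_beats_power (size ws) r01.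
have [a aM [pa pc]] := has_mean_kernels M Sws Sc.
set p := fun t => _ in pa pc.
have fac01 (w t : R) : 0 <= ((1 + cos (w * t)) / 2) ^+ M <= 1.
  have := cos_geN1 (w * t); have := cos_le1 (w * t) => h1 h2.
  by rewrite exprn_ge0 ?exprn_ile1//=; lra.
have p01 (us : seq R) (t : R) : 0 <= \prod_(w <- us) ((1 + cos (w * t)) / 2) ^+ M <= 1.
  elim: us => [|u us /andP[h1 h2]]; first by rewrite big_nil ler01 lexx.
  by rewrite big_cons; have /andP[h3 h4] := fac01 u t; rewrite mulr_ge0//= mulr_ile1.
(* Where cos(c t) >= 1/4 the bracket is nonnegative; elsewhere p <= r^M and the bracket is at least
   - (5/4) r^M. Taking means gives a <= 8 r^M, against the choice of M. *)
have f0 t : 0 <= 2 * r ^+ M + (p t * cos (c * t) + (- 4^-1) * p t).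
  have rM : 0 <= r ^+ M by case/andP: r01 => r0 _; rewrite exprn_ge0// ltW.
  have /andP[p0 p1] := p01 ws t; rewrite -/(p t) in p0 p1.
  have [c4|c4] := leP 4^-1 (cos (c * t)).
    by have := mulr_ge0 p0 (_ : 0 <= cos (c * t) - 4^-1); rewrite subr_ge0 => /(_ c4); lra.
  have [w [wws wt]] : exists w, w \in ws /\ cos (w * t) <= 1 - eta.
    apply: contrapT => /forallNP nw; apply: (noT t); split=> // w wws.
    by rewrite ltNge; apply/negP => h; apply: (nw w).
  have pr : p t <= r ^+ M.
    rewrite /p (perm_big _ (perm_to_rem wws)) big_cons /=.
    have /andP[q0 q1] := p01 (rem w ws) t; have /andP[f0 _] := fac01 w t.
    rewrite -[leRHS]mulr1; apply: ler_pM => //.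
    have := cos_geN1 (w * t) => hN; apply: lerXn2r; rewrite ?nnegrE /r; lra.
  have := cos_geN1 (c * t) => hN.
  have : 0 <= p t * (cos (c * t) + 1) by apply: mulr_ge0 => //; lra.
  lra.
have := has_mean_ge0 f0 (has_meanD (has_mean_cst _) (has_meanD pc (has_meanZ _ pa))).
by move: aM MC; lra.
Qed.

End MeanValue.

(** * Counting the frequencies *)

Section Frequencies.
Variable R : realType.
Local Notation P := (R * R)%type.

(** The real roots of nonzero integer polynomials form a countable set, while [0, 1] has positive
    Lebesgue measure. *)
Lemma exists_transcendental : exists tau : R, forall p : {poly int},
  p != 0 -> ~~ root (map_poly intr p) tau.
Proof.
apply: contrapT => /forallNP alg.
pose A := \bigcup_(p in [set p : {poly int} | p != 0])
  [set x : R | root (map_poly intr p) x].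
have cA : countable A.
  apply: bigcup_countable => [|p /= p0]; first exact: countableP.
  apply: finite_set_countable.
  have q0 : map_poly (intr : int -> R) p != 0.
    rewrite -size_poly_eq0 size_map_inj_poly ?size_poly_eq0//; exact: intr_inj.
  apply: contrapT => infA.
  (* An infinite set of roots would contain as many roots as the size of the polynomial, one more
     than its degree. *)
  have [B BA sB] := infinite_set_fset (size (map_poly (intr : int -> R) p)) infA.
  have := max_poly_roots (rs := enum_fset B) q0 _ (fset_uniq B).
  rewrite ltnNge sB => /(_ _)/negP; apply => //.
  by apply/allP => x xB; exact: BA.
have cI : countable [set` `[(0 : R), 1]].
  apply: sub_countable cA; apply: subset_card_le => x _.
  have /existsNP[p /not_implyP[p0 /negP]] := alg x.
  by rewrite negbK => px; exists p.
have := countable_lebesgue_measure0 cI.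
rewrite lebesgue_measure_itv /= lte_fin ltr01 -EFinB subr0 => /eqP.
by rewrite eqe oner_eq0.
Qed.

(** A nontrivial integer relation among the powers would be a nonzero integer polynomial vanishing
    at tau. *)
Lemma powers_independent (tau : R) N :
  (forall p : {poly int}, p != 0 -> ~~ root (map_poly intr p) tau) ->
  rationally_independent (fun i : 'I_N => tau ^+ i).
Proof.
move=> tr k k0 i.
pose p : {poly int} := \poly_(j < N) (if insub j is Some j' then k j' else 0).
have pi (j : 'I_N) : p`_j = k j by rewrite coef_poly ltn_ord valK.
have [p0|/tr] := eqVneq p 0; first by rewrite -pi p0 coef0.
have pE : (map_poly intr p).[tau] = \sum_(j < N) (k j)%:~R * tau ^+ j.
  rewrite (@horner_coef_wide _ N); last first.
    by rewrite (leq_trans (size_poly _ _))// size_poly.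
  by apply: eq_bigr => j _; rewrite coef_map /= pi.
by rewrite rootE pE k0 eqxx.
Qed.

Lemma independent_scale N (omega : 'I_N -> R) a : a != 0 ->
  rationally_independent omega -> rationally_independent (fun i => a * omega i).
Proof.
move=> a0 ind k k0; apply: ind; apply: (mulfI a0); rewrite mulr0 -[RHS]k0 mulr_sumr.
by apply: eq_bigr => i _; rewrite mulrCA.
Qed.

(** If m < N, the integer matrix expressing [omega] through [omega'] has a nonzero rational left
    kernel vector; clearing denominators yields a forbidden integer relation. *)
Lemma rank_independent N m (omega : 'I_N -> R) (omega' : 'I_m -> R) :
    rationally_independent omega ->
    (forall i, exists k : 'I_m -> int, omega i = \sum_(j < m) (k j)%:~R * omega' j) ->
  (N <= m)%N.
Proof.
move=> ind span; have [K KE] := choice span.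
rewrite leqNgt; apply/negP => mN.
pose A : 'M[rat]_(N, m) := \matrix_(i, j) (K i j)%:~R.
have : kermx A != 0.
  rewrite -mxrank_eq0 mxrank_ker -lt0n subn_gt0.
  by apply: leq_ltn_trans (rank_leq_col _) mN.
case/rowV0Pn => v vA v0; have {}vA : v *m A = 0 by apply/sub_kermxP.
pose D := \prod_(j < N) denq (v 0 j).
(* The integer v_i D, with the denominator of v_i cancelled against its factor in D. *)
pose k i := numq (v 0 i) * \prod_(j < N | j != i) denq (v 0 j).
have kE i : (k i)%:~R = v 0 i * D%:~R :> rat.
  have -> : D = denq (v 0 i) * \prod_(j < N | j != i) denq (v 0 j) by rewrite /D (bigD1 i).
  rewrite /k !intrM mulrA; congr (_ * _).
  by rewrite -{2}(divq_num_den (v 0 i)) mulfVK// intr_eq0 denq_neq0.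
have k0 : forall i, k i = 0.
  apply: ind; under eq_bigr do rewrite KE mulr_sumr.
  rewrite exchange_big /= big1// => j _.
  under eq_bigr do rewrite mulrA -intrM.
  rewrite -mulr_suml -(raddf_sum (intmul (1 : R))) /=.
  have -> : \sum_(i < N) k i * K i j = 0; last by rewrite mul0r.
  apply: (@intr_inj rat); rewrite raddf_sum /=.
  transitivity (D%:~R * (v *m A) 0 j); last by rewrite vA mxE mulr0.
  rewrite mxE mulr_sumr; apply: eq_bigr => i _.
  by rewrite intrM kE mxE; ring.
case/negP: v0; apply/eqP/rowP => i; rewrite mxE.
have /eqP := kE i; rewrite k0 eq_sym mulf_eq0 intr_eq0 => /orP[/eqP//|].
by rewrite prodf_seq_eq0 => /hasP[j _ /=]; rewrite denq_eq0.
Qed.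

Lemma torus_map_shift m (V : 'rV[R]_m -> P -> P) theta (k : 'I_m -> int) z :
    torus_map V -> strip z ->
  V (theta + \row_j (2 * pi * (k j)%:~R)) z = V theta z.
Proof.
move=> [tp _ _] sz.
have shiftn (n : nat) th i : V (th + (2 * pi * n%:R) *: delta_mx 0 i) z = V th z.
  elim: n => [|n IH]; first by rewrite mulr0 scale0r addr0.
  by rewrite -[n.+1%:R]natr1 mulrDr mulr1 scalerDl addrA tp// IH.
have shiftz (n : int) th i : V (th + (2 * pi * n%:~R) *: delta_mx 0 i) z = V th z.
  case: n => n; first exact: shiftn.
  rewrite NegzE mulrNz mulrN scaleNr.
  by rewrite -[in RHS](subrK ((2 * pi * n.+1%:R) *: delta_mx 0 i) th) shiftn.
have -> : \row_j (2 * pi * (k j)%:~R) =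
    \sum_(j < m) (2 * pi * (k j)%:~R) *: delta_mx 0 j :> 'rV[R]_m.
  by rewrite [LHS]row_sum_delta; apply: eq_bigr => j _; rewrite mxE.
elim: (index_enum _) theta => [|j s IH] theta; first by rewrite big_nil addr0.
by rewrite big_cons addrA IH shiftz.
Qed.

(** The cosine decreases on [0, pi]. Capping r at 1/2 keeps cos r positive, so that 1 - cos r <=
    1. *)
Lemma cos_near1 (rho : R) : 0 < rho -> exists2 eta, 0 < eta <= 1 &
  forall x, - pi <= x < pi -> 1 - eta < cos x -> `|x| < rho.
Proof.
move=> rho0; have p2 := pi_ge2 R.
pose r := Num.min rho 2^-1; have r0 : 0 < r by rewrite lt_min rho0 /=; lra.
have r1 : r <= 2^-1 by rewrite ge_min lexx orbT.
have rpi : r \in `[0, pi] by rewrite in_itv /=; apply/andP; lra.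
exists (1 - cos r).
  have : cos r < cos 0 by rewrite ltr_cos// in_itv /= lexx; lra.
  rewrite cos0 => h; have := cos_gt0_pihalf (x := r); rewrite (_ : - (pi / 2) < r < pi / 2).
    by move=> /(_ isT) h'; apply/andP; lra.
  by apply/andP; lra.
move=> x /andP[x1 x2]; rewrite opprB addrCA subrr addr0 -(cos_norm x).
have xpi : `|x| \in `[0, pi] by rewrite in_itv /= normr_ge0 ler_norml; apply/andP; lra.
by rewrite ltr_cos// => h; apply: lt_le_trans h _; rewrite ge_min lexx.
Qed.

(** The case k = 0 of [tm_continuous], the sup norm dominating the value at one point. *)
Lemma torus_map_cvg0 m (V : 'rV[R]_m -> P -> P) z e : torus_map V -> strip z -> 0 < e ->
  exists2 rho, 0 < rho & forall theta, `|theta| < rho -> `|V theta z - V 0 z| < e.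
Proof.
move=> [_ _ tc] sz e0.
pose h theta := Ck_norm 0 (V theta \- V 0)%R.
have /fine_cvgP[fn /cvgrPdist_lt/(_ e e0) near_e] := tc 0%N 0.
have nQ : nbhs (0 : 'rV[R]_m) (fun th => h th \is a fin_num /\ `|0 - fine (h th)| < e).
  exact: filterI fn near_e.
have [rho /= rho0 H] := (nbhs_ballP _ _).1 nQ.
exists rho => // theta th.
have [] := H theta; first by rewrite -ball_normE /ball_ /= sub0r normrN.
move=> fn' /=; rewrite sub0r normrN; apply: le_lt_trans; rewrite -lee_fin ger0_norm; last first.
  by apply: fine_ge0; exact: Ck_norm_ge0.
rewrite fineK// /h /Ck_norm big_ord1 big_mkcond /= big_ord1 addn0 leqnn.
by apply: ereal_sup_ubound; exists z.
Qed.

Variables (n N : nat) (c : 'I_N -> R) (delta : R).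
Hypothesis d0 : 0 < delta.
Hypothesis dN : delta * (4 * N%:R + 1) <= 1.

Lemma frequency_in_span m (omega : 'I_m -> R) (V : 'rV[R]_m -> P -> P) i :
    torus_map V ->
    (forall t z, strip z -> flow n c delta (phase n c delta t) z =
       V (\row_j (omega j * t)) z) ->
  exists k : 'I_m -> int, delta ^+ n * c i = \sum_(j < m) (k j)%:~R * omega j.
Proof.
(* The subgroup for [kronecker] is the integer span of the [omega j]; suppose the frequency lies
   outside it. *)
move=> tV uV; pose S (x : R) := exists k : 'I_m -> int, x = \sum_(j < m) (k j)%:~R * omega j.
apply: contrapT => nS; rewrite -/(S _) in nS.
have S0 : S 0 by exists (fun=> 0); rewrite big1// => j _; rewrite mul0r.
have SD x y : S x -> S y -> S (x + y).
  move=> [k ->] [l ->]; exists (fun j => k j + l j); rewrite -big_split /=.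
  by apply: eq_bigr => j _; rewrite intrD mulrDl.
have SN x : S x -> S (- x).
  move=> [k ->]; exists (fun j => - k j); rewrite -sumrN.
  by apply: eq_bigr => j _; rewrite mulrNz mulNr.
have Sw w : w \in [seq omega j | j : 'I_m] -> S w.
  case/mapP => j _ ->; exists (fun l => (l == j)%:Z).
  rewrite (bigD1 j)//= eqxx mul1r big1 ?addr0// => l /negbTE ->; exact: mul0r.
have sz : strip (probe delta i) by exact: strip_level.
have w0 : flow n c delta (phase n c delta 0) (probe delta i) = V 0 (probe delta i).
  by rewrite uV//; congr V; apply/rowP => j; rewrite !mxE mulr0.
have pos : 0 < (V 0 (probe delta i)).2.
  by rewrite -w0; apply: flow_probe_gt0 => //; rewrite mxE mulr0.
have [rho rho0 Hrho] := torus_map_cvg0 tV sz pos.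
have [eta eta01 Heta] := cos_near1 rho0.
have [t [tn tf]] := kronecker S0 SD SN Sw nS eta01.
(* With phases reduced to [-pi, pi), V is unchanged, and cosines close to 1 mean entries close to
   0. *)
pose th : 'rV[R]_m := \row_j (omega j * t - winding (omega j * t)).
have thV : V th (probe delta i) = flow n c delta (phase n c delta t) (probe delta i).
  rewrite uV//; pose k j := Num.floor ((omega j * t + pi) / (2 * pi)).
  rewrite -(torus_map_shift th k tV sz); congr V; apply/rowP => j.
  by rewrite !mxE /winding -/(k j) subrK.
have : `|th| < rho.
  rewrite /Num.norm/= mx_normrE; apply: bigmax_lt => // -[a j] _ /=.
  rewrite mxE; apply: Heta; first exact: winding_itv.
  by rewrite cos_winding; apply: tn; apply: map_f; rewrite mem_enum.
move/Hrho; rewrite thV; move: (V 0 _) pos => q q0.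
(* The vortex has left the probe at time t, although continuity of V puts the vertical velocity at a
   distance from its initial value q.2 smaller than q.2. *)
have e0 : (flow n c delta (phase n c delta t) (probe delta i)).2 = 0.
  by apply: flow_probe_eq0; rewrite // mxE.
rewrite pair_normE gt_max => /andP[_].
rewrite -[X in `|X|]/((flow n c delta (phase n c delta t) (probe delta i)).2 - q.2) e0.
by rewrite sub0r normrN gtr0_norm// ltxx.
Qed.

Lemma flow_quasiperiodic : rationally_independent c ->
  quasiperiodic N (fun t => flow n c delta (phase n c delta t)).
Proof.
move=> ind; have dn0 : delta ^+ n != 0 by rewrite gt_eqF// exprn_gt0.
have indw := independent_scale dn0 ind; split.
  exists (fun i => delta ^+ n * c i), (flow n c delta).
  by split; [exact: indw|exact: flow_torus_map|move=> t z _; rewrite /phase].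
move=> m mN [omega [V [_ tV uV]]].
have := rank_independent indw (fun i => frequency_in_span i tV uV).
by rewrite leqNgt mN.
Qed.

Lemma flow_time_periodic (i : 'I_N) : (forall j, c j = 1) ->
  time_periodic (fun t => flow n c delta (phase n c delta t)).
Proof.
move=> c1; have dn0 : 0 < delta ^+ n by rewrite exprn_gt0.
have [tp _ _] := flow_torus_map n c d0 dN.
(* After half a period the phase is pi and the vortex is off the probe. *)
have h : cos (phase n c delta (pi / delta ^+ n) 0 i) < 4^-1.
  by rewrite mxE c1 mulr1 mulrC divfK ?gt_eqF// cospi; lra.
split.
  move=> /(_ 0 (pi / delta ^+ n) (probe delta i) (strip_level d0 dN _ i)) e.
  have pos : 0 < (flow n c delta (phase n c delta 0) (probe delta i)).2.
    have h0 : phase n c delta 0 0 i = 0 by rewrite mxE mulr0.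
    exact: (flow_probe_gt0 n c d0 dN h0).
  have zero : (flow n c delta (phase n c delta (pi / delta ^+ n)) (probe delta i)).2 = 0.
    exact: (flow_probe_eq0 n c d0 dN h).
  by move: pos; rewrite e zero ltxx.
exists (2 * pi / delta ^+ n); first by rewrite divr_gt0// mulr_gt0// pi_gt0.
move=> t z sz; rewrite -(torus_map_shift (phase n c delta t) (fun=> 1) (flow_torus_map n c d0 dN) sz).
have -> // : phase n c delta (t + 2 * pi / delta ^+ n) =
    phase n c delta t + \row_j (2 * pi * (1 : int)%:~R).
apply/rowP => j; rewrite !mxE c1 !mulr1.
by field; rewrite gt_eqF.
Qed.

Lemma flow_stationary : (forall j, c j = 0) ->
  stationary (fun t => flow n c delta (phase n c delta t)).
Proof.
move=> c0 t s z _.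
have -> // : phase n c delta t = phase n c delta s.
by apply/rowP => j; rewrite !mxE c0 !mulr0 !mul0r.
Qed.

End Frequencies.

Theorem theorem1p3 (R : realType) (n : nat) (hn : (1 <= n)%N)
    (eps : R) (heps : 0 < eps) (alpha : R) (halpha : 0 < alpha < 1) :
  [/\ exists u : R -> R * R -> R * R,
        [/\ euler_solution u, non_shear u, stationary u
          & forall t, (holder_norm n.-1 alpha (u t \- @power_shear R n)%R
                       < eps%:E)%E],
      exists u : R -> R * R -> R * R,
        [/\ euler_solution u, non_shear u, time_periodic u
          & forall t, (holder_norm n.-1 alpha (u t \- @power_shear R n)%R
                       < eps%:E)%E]
    & forall N : nat, (1 <= N)%N ->
      exists u : R -> R * R -> R * R,
        [/\ euler_solution u, non_shear u, quasiperiodic N u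
          & forall t, (holder_norm n.-1 alpha (u t \- @power_shear R n)%R
                       < eps%:E)%E]].
Proof.
(* The three types differ in the speeds c alone; the index i supplies at least one vortex, hence a
   non-shear flow. *)
have common N (c : 'I_N -> R) (i : 'I_N) : exists delta, [/\ 0 < delta,
    delta * (4 * N%:R + 1) <= 1,
    euler_solution (fun t => flow n c delta (phase n c delta t)),
    non_shear (fun t => flow n c delta (phase n c delta t)) &
    forall t, (holder_norm n.-1 alpha
      (flow n c delta (phase n c delta t) \- @power_shear R n)%R < eps%:E)%E].
  have [delta [d0 dN close]] := flow_close c hn heps halpha.
  exists delta; split => //; first exact: flow_euler.
  by move=> t; exact: flow_non_shear.
split.
- pose c (i : 'I_1) : R := 0.
  have [delta [d0 dN eu ns close]] := common 1%N c ord0.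
  exists (fun t => flow n c delta (phase n c delta t)).
  by split; [exact: eu|exact: ns|exact: flow_stationary|exact: close].
- pose c (i : 'I_1) : R := 1.
  have [delta [d0 dN eu ns close]] := common 1%N c ord0.
  exists (fun t => flow n c delta (phase n c delta t)).
  by split; [exact: eu|exact: ns|exact: (flow_time_periodic n d0 dN ord0)|exact: close].
- move=> N N1; have [tau tr] := exists_transcendental R.
  pose c (i : 'I_N) := tau ^+ i.
  have [delta [d0 dN eu ns close]] := common N c (Ordinal N1).
  exists (fun t => flow n c delta (phase n c delta t)).
  split; [exact: eu|exact: ns| |exact: close].
  by apply: (flow_quasiperiodic n d0 dN); exact: powers_independent.
Qed.
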